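(* Let $U$, $V$ and $W$ be absolute matrix order unit spaces, and let $\phi:U\to V$ and $\psi:V\to W$ be unital completely $|\cdot|$-preserving maps. Then (a) $K_1(I_V)=I_{K_1(V)}$, where $I_V$ and $I_{K_1(V)}$ are the identity maps of $V$ and of $K_1(V)$; (b) $K_1(\psi\circ\phi)=K_1(\psi)\circ K_1(\phi)$.
   Context: Matrices. For a complex $*$-vector space $V$ (complex vector space with a conjugate-linear involution $*$), $M_{m,n}(V)$ denotes the $m\times n$ matrices over $V$, $M_n(V)=M_{n,n}(V)$, $M_{m,n}=M_{m,n}(\mathbb{C})$, $M_n=M_{n,n}$; products $\alpha v$, $v\beta$ with scalar matrices are the usual ones, $[v_{i,j}]^*=[v_{j,i}^*]$, $M_n(V)_{sa}=\{v\in M_n(V):v=v^*\}$, $v\oplus w=\begin{bmatrix}v&0\\0&w\end{bmatrix}$, and $0_n$ is the zero of $M_n(V)$. A matrix ordered space is a $*$-vector space $V$ with sets $M_n(V)^+\subset M_n(V)_{sa}$ ($n\in\mathbb{N}$) such that each $(M_n(V)_{sa},M_n(V)^+)$ is a real ordered vector space ($M_n(V)^+$ is a cone: closed under sums and nonnegative scalar multiples; $u\le v$ means $v-u\in M_n(V)^+$) and $\alpha^*v\alpha\in M_m(V)^+$ for all $v\in M_n(V)^+$, $\alpha\in M_{n,m}$. Write $V^+=M_1(V)^+$. An absolutely ordered space is a real ordered vector space $(X,X^+)$ with a map $|\cdot|:X\to X^+$ such that: (1) $|x|=x$ for $x\in X^+$; (2) $|x|\pm x\in X^+$ for $x\in X$;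 (3) $|kx|=|k||x|$ for $k\in\mathbb{R}$; (4) if $|x-y|=x+y$ and $0\le z\le y$, then $|x-z|=x+z$; (5) if $|x-y|=x+y$ and $|x-z|=x+z$, then $\big|x-|y\pm z|\big|=x+|y\pm z|$. An absolutely matrix ordered space is a matrix ordered space with maps $|\cdot|_{m,n}:M_{m,n}(V)\to M_n(V)^+$ (write $|\cdot|_n=|\cdot|_{n,n}$) such that: each $(M_n(V)_{sa},M_n(V)^+,|\cdot|_n)$ is an absolutely ordered space; $|\alpha v\beta|_{r,s}\le\|\alpha\|\,\big||v|_{m,n}\beta\big|_{n,s}$ for $v\in M_{m,n}(V)$, $\alpha\in M_{r,m}$, $\beta\in M_{n,s}$; and $|v\oplus w|_{m+r,n+s}=|v|_{m,n}\oplus|w|_{r,s}$ for $v\in M_{m,n}(V)$, $w\in M_{r,s}(V)$. For $u,v\in M_n(V)^+$, $u\perp v$ means $|u-v|_n=u+v$. A matrix order unit space $(V,e)$ is a matrix ordered space with an order unit $e\in V^+$ for $V_{sa}$ (every $v\in V_{sa}$ satisfies $ke\pm v\in V^+$ for some $k>0$), with $V^+$ proper ($V^+\cap(-V^+)=\{0\}$) and every $M_n(V)^+$ Archimedean (if $v\in M_n(V)_{sa}$ and $ku+v\in M_n(V)^+$ for a fixed $u\in M_n(V)^+$ and all $k>0$, then $v\in M_n(V)^+$). Put $e^n=e\oplus\cdots\oplus e\in M_n(V)$. It carries the norms $\|v\|_n=\inf\{k>0:\begin{bmatrix}ke^n&v\\ v^*&ke^n\end{bmatrix}\in M_{2n}(V)^+\}$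 on $M_n(V)$; continuity is with respect to these norms. For $u,v\in M_n(V)^+$, $u\perp_\infty v$ means $\|u+kv\|_n=\max\{\|u\|_n,\|kv\|_n\}$ for all $k\in\mathbb{R}$, and $u\perp_\infty^a v$ means $u_1\perp_\infty v_1$ whenever $0\le u_1\le u$ and $0\le v_1\le v$. An absolute matrix order unit space is a matrix order unit space $(V,e)$ that is also an absolutely matrix ordered space and for which $\perp=\perp_\infty^a$ on $M_n(V)^+$ for every $n$. Unitaries and $K_1$. $u\in M_n(V)$ is unitary if $|u|_n=e^n=|u^*|_n$; $\mathcal{U}_n(V)$ is the set of unitaries in $M_n(V)$ and $\mathcal{U}_\infty(V)=\bigcup_{n=1}^\infty\mathcal{U}_n(V)$ (each element is a matrix of a definite size). For $u,v\in\mathcal{U}_n(V)$, $u\sim_h v$ means there is a continuous $f:[0,1]\to\mathcal{U}_n(V)$ with $f(0)=u$, $f(1)=v$. For $u\in\mathcal{U}_m(V)$, $v\in\mathcal{U}_n(V)$, $u\sim_1 v$ means there is $k>\max\{m,n\}$ with $u\oplus e^{k-m}\sim_h v\oplus e^{k-n}$ in $\mathcal{U}_k(V)$. For $u,v\in\mathcal{U}_\infty(V)$, $u\approx_1 v$ means there is $w\in\mathcal{U}_\infty(V)$ with $u\oplus w\sim_1 v\oplus w$. On $\mathcal{U}_\infty(V)\times\mathcal{U}_\infty(V)$ the equivalence relation $(u_1,v_1)\equiv_1(u_2,v_2)\iff u_1\oplus v_2\approx_1 u_2\oplus v_1$ has classes $[(u,v)]$; $K_1(V)$ is the set of these classes,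 an abelian group under $[(u_1,v_1)]+[(u_2,v_2)]=[(u_1\oplus u_2,v_1\oplus v_2)]$. Morphisms. For a linear map $\phi:V\to W$, $\phi_n:M_n(V)\to M_n(W)$ is the entrywise application of $\phi$, also written $\phi$. A $*$-linear map $\phi$ between absolute matrix order unit spaces is completely $|\cdot|$-preserving if $|\phi_n(v)|_n=\phi_n(|v|_n)$ for all $v\in M_n(V)$ and $n\in\mathbb{N}$, and unital if it maps order unit to order unit. For $\phi:V\to W$ unital completely $|\cdot|$-preserving, $K_1(\phi):K_1(V)\to K_1(W)$ is the unique group homomorphism with $K_1(\phi)([(v,e_V)])=[(\phi(v),e_W)]$ for all $v\in\mathcal{U}_\infty(V)$; it is given by $K_1(\phi)([(v,w)])=[(\phi(v),\phi(w))]$. *)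

(* Defs.v *)
From HB Require Import structures.
From mathcomp Require Import all_boot all_order all_algebra.
From mathcomp Require Import all_classical all_reals.
From mathcomp Require Import complex.

Set Implicit Arguments.
Unset Strict Implicit.
Unset Printing Implicit Defensive.

Import Order.TTheory GRing.Theory Num.Theory.
Local Open Scope classical_set_scope.
Local Open Scope ring_scope.
Local Open Scope complex_scope.

(* Complex scalars are [R[i]] for an arbitrary [R : realType].  Matrices over a
   complex vector space [V] are ['M[V]_(m, n)].  MathComp has no scalar action
   on them when [V] is not a ring, so those actions are defined below.
   Matrix sizes are positive: families are indexed by all of [nat], but axioms
   and definitions only constrain sizes [n] with [0 < n]. *)

Section ScalarMatrices.
Context {R : realType}.

Definition ctrmx m n (a : 'M[R[i]]_(m, n)) : 'M[R[i]]_(n, m) :=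
  map_mx (@conjc R) a^T.

Definition l2norm n (x : 'cV[R[i]]_n) : R :=
  Num.sqrt (\sum_(i < n) (complex.Re (x i 0) ^+ 2 + complex.Im (x i 0) ^+ 2)).

Definition opnorm m n (a : 'M[R[i]]_(m, n)) : R :=
  sup [set l2norm (a *m x) | x in [set x : 'cV[R[i]]_n | l2norm x <= 1]].

End ScalarMatrices.

Section VectorMatrices.
Context {R : realType} {V : lmodType R[i]}.

Definition scalemxl m n p (a : 'M[R[i]]_(m, n)) (v : 'M[V]_(n, p)) :
    'M[V]_(m, p) :=
  \matrix_(i, j) \sum_k a i k *: v k j.

Definition scalemxr m n p (v : 'M[V]_(m, n)) (b : 'M[R[i]]_(n, p)) :
    'M[V]_(m, p) :=
  \matrix_(i, j) \sum_k b k j *: v i k.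

Definition rscalemx m n (k : R) (v : 'M[V]_(m, n)) : 'M[V]_(m, n) :=
  map_mx (fun x => k%:C *: x) v.

Definition dsummx m n r s (v : 'M[V]_(m, n)) (w : 'M[V]_(r, s)) :
    'M[V]_(m + r, n + s) :=
  block_mx v 0 0 w.

Definition diagmx (e : V) n : 'M[V]_n :=
  \matrix_(i, j) if i == j then e else 0.

Lemma diagmxD (e : V) m n : diagmx e (m + n) = dsummx (diagmx e m) (diagmx e n).
Proof.
apply/matrixP => i j; rewrite mxE.
case: (split_ordP i) => i' ->; case: (split_ordP j) => j' ->.
- by rewrite block_mxEul mxE (inj_eq (@lshift_inj _ _)).
- by rewrite block_mxEur mxE eq_lrshift.
- by rewrite block_mxEdl mxE eq_rlshift.
- by rewrite block_mxEdr mxE (inj_eq (@rshift_inj _ _)).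
Qed.

Lemma diagmx1 (e : V) : diagmx e 1 = const_mx e.
Proof. by apply/matrixP => i j; rewrite !mxE !ord1. Qed.

End VectorMatrices.

(* The real vector space is given as a subset [X] of an additive group [E],
   with real scalar multiplication [sc]: it will be [M_n(V)_sa] in [M_n(V)]. *)
Section RealOrdered.
Context {R : realType} {E : zmodType}.
Variables (sc : R -> E -> E) (X P : set E).

Record is_cone : Prop := IsCone {
  cone_sub : P `<=` X;
  cone_0 : P 0;
  cone_add : forall x y, P x -> P y -> P (x + y);
  cone_scale : forall (k : R) x, 0 <= k -> P x -> P (sc k x) }.

Definition le_cone (x y : E) : Prop := P (y - x).

Record absolutely_ordered (abs : E -> E) : Prop := AbsolutelyOrdered {
  abs_in_cone : forall x, X x -> P (abs x);
  abs_cone : forall x, P x -> abs x = x;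
  abs_ge : forall x, X x -> P (abs x + x) /\ P (abs x - x);
  abs_scale : forall (k : R) x, X x -> abs (sc k x) = sc `|k| (abs x);
  abs_orth_le : forall x y z, X x -> X y -> X z ->
    abs (x - y) = x + y -> le_cone 0 z -> le_cone z y -> abs (x - z) = x + z;
  abs_orth_add : forall x y z, X x -> X y -> X z ->
    abs (x - y) = x + y -> abs (x - z) = x + z ->
    abs (x - abs (y + z)) = x + abs (y + z) /\
    abs (x - abs (y - z)) = x + abs (y - z) }.

End RealOrdered.

HB.mixin Record isStarVector (R : realType) V of GRing.Lmodule R[i] V := {
  star : V -> V;
  starK : involutive star;
  starD : forall x y : V, star (x + y) = star x + star y;
  starZ : forall (a : R[i]) (x : V), star (a *: x) = conjc a *: star x }.

#[short(type="starVectorType")]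
HB.structure Definition StarVector (R : realType) :=
  {V of GRing.Lmodule R[i] V & isStarVector R V}.

Section StarMatrices.
Context {R : realType} {V : starVectorType R}.

Definition starmx m n (v : 'M[V]_(m, n)) : 'M[V]_(n, m) := map_mx star v^T.

Definition selfadj n : set 'M[V]_n := [set v | starmx v = v].

Lemma star0 : star (0 : V) = 0.
Proof. by apply: (@addrI V (star 0)); rewrite -starD !addr0. Qed.

Lemma starmx_dsum m n r s (v : 'M[V]_(m, n)) (w : 'M[V]_(r, s)) :
  starmx (dsummx v w) = dsummx (starmx v) (starmx w).
Proof.
rewrite /starmx /dsummx tr_block_mx map_block_mx; congr block_mx;
  by apply/matrixP => i j; rewrite !mxE star0.
Qed.

End StarMatrices.

HB.mixin Record isMatrixOrdered (R : realType) V of StarVector R V := {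
  mxpos : forall n, set 'M[V]_n;
  mxpos_cone : forall n, (0 < n)%N ->
    is_cone (@rscalemx R V n n) (@selfadj R V n) (mxpos n);
  mxpos_conj : forall m n (a : 'M[R[i]]_(n, m)) (v : 'M[V]_n),
    (0 < m)%N -> (0 < n)%N ->
    mxpos n v -> mxpos m (scalemxr (scalemxl (ctrmx a) v) a) }.

#[short(type="matrixOrderedType")]
HB.structure Definition MatrixOrdered (R : realType) :=
  {V of StarVector R V & isMatrixOrdered R V}.

Arguments mxpos {R s n} v : rename.

Definition lemx (R : realType) (V : matrixOrderedType R) n (u v : 'M[V]_n) :=
  le_cone (@mxpos R V n) u v.

HB.mixin Record isAbsMatrixOrdered (R : realType) V of MatrixOrdered R V := {
  absmx : forall m n, 'M[V]_(m, n) -> 'M[V]_n;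
  absmx_pos : forall m n (v : 'M[V]_(m, n)), (0 < m)%N -> (0 < n)%N ->
    mxpos (absmx m n v);
  absmx_ordered : forall n, (0 < n)%N ->
    absolutely_ordered (@rscalemx R V n n) (@selfadj R V n) (@mxpos R V n)
      (absmx n n);
  absmx_le : forall m n r p (a : 'M[R[i]]_(r, m)) (v : 'M[V]_(m, n))
      (b : 'M[R[i]]_(n, p)),
    (0 < m)%N -> (0 < n)%N -> (0 < r)%N -> (0 < p)%N ->
    lemx (absmx r p (scalemxr (scalemxl a v) b))
         (rscalemx (opnorm a) (absmx n p (scalemxr (absmx m n v) b)));
  absmx_dsum : forall m n r p (v : 'M[V]_(m, n)) (w : 'M[V]_(r, p)),
    (0 < m)%N -> (0 < n)%N -> (0 < r)%N -> (0 < p)%N ->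
    absmx (m + r)%N (n + p)%N (dsummx v w) =
    dsummx (absmx m n v) (absmx r p w) }.

#[short(type="absMatrixOrderedType")]
HB.structure Definition AbsMatrixOrdered (R : realType) :=
  {V of MatrixOrdered R V & isAbsMatrixOrdered R V}.

Arguments absmx {R s m n} v : rename.

(* [V] is identified with [M_1(V)] through [const_mx]. *)
Definition vpos (R : realType) (V : matrixOrderedType R) (v : V) : Prop :=
  mxpos (const_mx v : 'M[V]_1).

HB.mixin Record isMatrixOrderUnit (R : realType) V of MatrixOrdered R V := {
  ounit : V;
  ounit_pos : vpos ounit;
  ounitP : forall v : V, star v = v ->
    exists k : R, [/\ 0 < k, vpos (k%:C *: ounit + v)
                    & vpos (k%:C *: ounit - v)];
  vpos_proper : forall v : V, vpos v -> vpos (- v) -> v = 0;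
  mxpos_archimedean : forall n (u v : 'M[V]_n), (0 < n)%N ->
    selfadj v -> mxpos u ->
    (forall k : R, 0 < k -> mxpos (rscalemx k u + v)) -> mxpos v }.

#[short(type="matrixOrderUnitType")]
HB.structure Definition MatrixOrderUnit (R : realType) :=
  {V of MatrixOrdered R V & isMatrixOrderUnit R V}.

Section MatrixNorm.
Context {R : realType} {V : matrixOrderUnitType R}.

Definition unitmx_of n : 'M[V]_n := diagmx ounit n.

Definition mxnorm n (v : 'M[V]_n) : R :=
  inf [set k : R | 0 < k /\
    mxpos (block_mx (rscalemx k (unitmx_of n)) v
                    (starmx v) (rscalemx k (unitmx_of n)))].

Definition orth_infty n (u v : 'M[V]_n) : Prop :=
  forall k : R, mxnorm (u + rscalemx k v) =
                Num.max (mxnorm u) (mxnorm (rscalemx k v)).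

Definition abs_orth_infty n (u v : 'M[V]_n) : Prop :=
  forall u1 v1 : 'M[V]_n, lemx 0 u1 -> lemx u1 u -> lemx 0 v1 -> lemx v1 v ->
    orth_infty u1 v1.

End MatrixNorm.

Arguments unitmx_of {R} V n.

HB.mixin Record isAbsMatrixOrderUnit (R : realType) V
    of AbsMatrixOrdered R V & MatrixOrderUnit R V := {
  orth_absE : forall n (u v : 'M[V]_n), (0 < n)%N -> mxpos u -> mxpos v ->
    (absmx (u - v) = u + v <-> abs_orth_infty u v) }.

#[short(type="absMatrixOrderUnitType")]
HB.structure Definition AbsMatrixOrderUnit (R : realType) :=
  {V of AbsMatrixOrdered R V & MatrixOrderUnit R V & isAbsMatrixOrderUnit R V}.

HB.mixin Record isUnitalAbsPreserving (R : realType)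
    (V W : absMatrixOrderUnitType R) (f : V -> W) := {
  star_morph : forall v : V, f (star v) = star (f v);
  absmx_morph : forall n (v : 'M[V]_n), (0 < n)%N ->
    absmx (map_mx f v) = map_mx f (absmx v);
  ounit_morph : f ounit = ounit }.

#[short(type="unitalAbsMorphism")]
HB.structure Definition UnitalAbsMorphism (R : realType)
    (V W : absMatrixOrderUnitType R) :=
  {f of @GRing.Linear R[i] V W *:%R f & @isUnitalAbsPreserving R V W f}.

Section IdMorphism.
Variables (R : realType) (V : absMatrixOrderUnitType R).

Lemma idfun_star_morph (v : V) : idfun (star v) = star (idfun v).
Proof. by []. Qed.

Lemma idfun_absmx_morph n (v : 'M[V]_n) : (0 < n)%N ->
  absmx (map_mx idfun v) = map_mx idfun (absmx v).
Proof. by move=> _; rewrite !map_mx_id. Qed.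

HB.instance Definition _ :=
  @isUnitalAbsPreserving.Build R V V idfun
    idfun_star_morph idfun_absmx_morph erefl.

End IdMorphism.

Section CompMorphism.
Variables (R : realType) (U V W : absMatrixOrderUnitType R).
Variables (g : unitalAbsMorphism V W) (f : unitalAbsMorphism U V).

Lemma comp_star_morph (v : U) : (g \o f) (star v) = star ((g \o f) v).
Proof. by rewrite /= !star_morph. Qed.

Lemma comp_absmx_morph n (v : 'M[U]_n) : (0 < n)%N ->
  absmx (map_mx (g \o f) v) = map_mx (g \o f) (absmx v).
Proof.
move=> n0; have mapE (A : 'M[U]_n) : map_mx (g \o f) A = map_mx g (map_mx f A).
  by apply/matrixP => i j; rewrite !mxE.
by rewrite mapE absmx_morph // absmx_morph // -mapE.
Qed.

Lemma comp_ounit_morph : (g \o f) ounit = ounit.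
Proof. by rewrite /= !ounit_morph. Qed.

HB.instance Definition _ :=
  @isUnitalAbsPreserving.Build R U W (g \o f)
    comp_star_morph comp_absmx_morph comp_ounit_morph.

End CompMorphism.

Section Unitaries.
Context {R : realType} {V : absMatrixOrderUnitType R}.

Definition is_unitary n (u : 'M[V]_n) : Prop :=
  absmx u = unitmx_of V n /\ absmx (starmx u) = unitmx_of V n.

(* A path is a function on [R] of which only the values on [0, 1] matter. *)
Definition homotopic n (u v : 'M[V]_n) : Prop :=
  exists f : R -> 'M[V]_n,
    [/\ forall t, 0 <= t <= 1 -> is_unitary (f t),
        forall t, 0 <= t <= 1 -> forall eps, 0 < eps ->
          exists2 delta, 0 < delta &
            forall s, 0 <= s <= 1 -> `|s - t| < delta ->
              mxnorm (f s - f t) < eps,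
        f 0 = u & f 1 = v].

Lemma is_unitary_dsum m n (u : 'M[V]_m) (v : 'M[V]_n) :
  (0 < m)%N -> (0 < n)%N ->
  is_unitary u -> is_unitary v -> is_unitary (dsummx u v).
Proof.
move=> m0 n0 [u1 u2] [v1 v2]; split.
  by rewrite absmx_dsum // u1 v1 /unitmx_of diagmxD.
by rewrite starmx_dsum absmx_dsum // u2 v2 /unitmx_of diagmxD.
Qed.

Lemma is_unitary_unit : is_unitary (unitmx_of V 1).
Proof.
have e_pos : mxpos (unitmx_of V 1) by rewrite /unitmx_of diagmx1; exact: ounit_pos.
have e_abs := abs_cone (absmx_ordered (s := V) 1 (ltn0Sn 0)) e_pos.
split=> //; suff -> : starmx (unitmx_of V 1) = unitmx_of V 1 by [].
exact: (cone_sub (mxpos_cone (s := V) 1 (ltn0Sn 0)) e_pos).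
Qed.

End Unitaries.

Record unitary (R : realType) (V : absMatrixOrderUnitType R) := Unitary {
  usize : nat;
  usize_gt0 : (0 < usize)%N;
  umx : 'M[V]_usize;
  umxP : is_unitary umx }.

Section UnitaryOps.
Context {R : realType} {V : absMatrixOrderUnitType R}.

Definition unitary1 : unitary V := Unitary (ltn0Sn 0) is_unitary_unit.

Lemma usize_dsum_gt0 (u v : unitary V) : (0 < usize u + usize v)%N.
Proof. by rewrite addn_gt0 usize_gt0. Qed.

Definition udsum (u v : unitary V) : unitary V :=
  Unitary (usize_dsum_gt0 u v)
    (is_unitary_dsum (usize_gt0 u) (usize_gt0 v) (umxP u) (umxP v)).

(* [padmx k lt_nk u] is the direct sum of [u] and [e^(k - n)], seen in
   [M_k(V)]. *)
Definition padmx n k (lt_nk : (n < k)%N) (u : 'M[V]_n) : 'M[V]_k :=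
  castmx (subnKC (ltnW lt_nk), subnKC (ltnW lt_nk))
    (dsummx u (unitmx_of V (k - n))).

Definition sim1 (u v : unitary V) : Prop :=
  exists (k : nat) (lt_uk : (usize u < k)%N) (lt_vk : (usize v < k)%N),
    homotopic (padmx lt_uk (umx u)) (padmx lt_vk (umx v)).

Definition approx1 (u v : unitary V) : Prop :=
  exists w : unitary V, sim1 (udsum u w) (udsum v w).

Definition equiv1 (p q : unitary V * unitary V) : Prop :=
  approx1 (udsum p.1 q.2) (udsum q.1 p.2).

End UnitaryOps.

Section UnitaryMap.
Context {R : realType} {V W : absMatrixOrderUnitType R}.
Variable f : unitalAbsMorphism V W.

Lemma map_unitmx_of n : map_mx f (unitmx_of V n) = unitmx_of W n.
Proof.
by apply/matrixP => i j; rewrite !mxE; case: ifP; rewrite ?ounit_morph ?raddf0.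
Qed.

Lemma is_unitary_map n (u : 'M[V]_n) :
  (0 < n)%N -> is_unitary u -> is_unitary (map_mx f u).
Proof.
move=> n0 [u1 u2]; split; first by rewrite absmx_morph // u1 map_unitmx_of.
have -> : starmx (map_mx f u) = map_mx f (starmx u).
  by apply/matrixP => i j; rewrite !mxE star_morph.
by rewrite absmx_morph // u2 map_unitmx_of.
Qed.

Definition umap (u : unitary V) : unitary W :=
  Unitary (usize_gt0 u) (is_unitary_map (usize_gt0 u) (umxP u)).

End UnitaryMap.

Definition K1 (R : realType) (V : absMatrixOrderUnitType R) : Type :=
  {A : set (unitary V * unitary V) | exists p, A = [set q | equiv1 p q]}.

Section K1.
Context {R : realType} {V : absMatrixOrderUnitType R}.

Definition K1_class (p : unitary V * unitary V) : K1 V :=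
  exist _ [set q | equiv1 p q] (ex_intro _ p erefl).

Definition K1_repr (x : K1 V) : unitary V * unitary V := sval (cid (svalP x)).

Lemma K1_reprK : cancel K1_repr K1_class.
Proof.
move=> x; rewrite /K1_repr; case: cid => p /= xp.
by case: x xp => A hA /= xp; apply: eq_exist.
Qed.

Definition K1_add (x y : K1 V) : K1 V :=
  K1_class (udsum (K1_repr x).1 (K1_repr y).1,
            udsum (K1_repr x).2 (K1_repr y).2).

HB.instance Definition _ := gen_eqMixin (K1 V).
HB.instance Definition _ := gen_choiceMixin (K1 V).
HB.instance Definition _ :=
  isPointed.Build (K1 V) (K1_class (unitary1, unitary1)).

End K1.

Definition is_K1_map (R : realType) (V W : absMatrixOrderUnitType R)
    (f : unitalAbsMorphism V W) (F : K1 V -> K1 W) : Prop :=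
  (forall x y, F (K1_add x y) = K1_add (F x) (F y)) /\
  (forall v : unitary V,
    F (K1_class (v, unitary1)) = K1_class (umap f v, unitary1)).

(* Definite description: [K1_add] does not depend on representatives, and
   exactly one [F] satisfies [is_K1_map f F].  That [F] sends the class of
   [(v, w)] to the class of [(umap f v, umap f w)]. *)
Definition K1_map (R : realType) (V W : absMatrixOrderUnitType R)
    (f : unitalAbsMorphism V W) : K1 V -> K1 W :=
  get [set F | is_K1_map f F].

(* Main.v *)
(** A map [f] determines [K1_map f] through its values on the classes of
    [(v, e)], because [(u, v) + (v, e)] and [(u, e)] have the same class and
    [K_1] is cancellative.  Both claims then reduce to checking that the
    identity and the composite are homomorphisms with the right values there.

    The substance is that [K_1(V)] is a group on which [f] acts.  Commutativity
    of the direct sum up to [sim1] holds because a permutation matrix is a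
    product of transpositions [S], which are self-adjoint scalar unitaries, and
    a unitary [w] is joined to [S w S] by conjugating it with the scalar
    unitaries [sqrt (1 - t) + i (sqrt t) S].  Functoriality holds because [f],
    preserving absolute values, is completely positive and hence contracts the
    matrix norms; as these are infima of sets that could be empty, one first
    bounds a unitary [u] through the matrix with off-diagonal blocks [u] and
    [u^*], whose absolute value is dominated by a multiple of the unit. *)

From mathcomp Require Import all_boot all_order all_algebra all_fingroup.
From mathcomp Require Import all_classical all_reals.
From mathcomp Require Import complex ring lra zify.
Require Import Defs.

Set Implicit Arguments.
Unset Strict Implicit.
Unset Printing Implicit Defensive.

Import Order.TTheory GRing.Theory Num.Theory.
Local Open Scope classical_set_scope.
Local Open Scope ring_scope.
Local Open Scope complex_scope.

(** * Matrices over a module *)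

Section ScalarMatrices.
Context {R : realType}.

Lemma conjc_mul_self (z : R[i]) :
  conjc z * z = (complex.Re z ^+ 2 + complex.Im z ^+ 2)%:C.
Proof. by case: z => a b /=; simpc; congr (_ +i* _); ring. Qed.

Lemma ctrmx_mul m n p (a : 'M[R[i]]_(m, n)) (b : 'M_(n, p)) :
  ctrmx (a *m b) = ctrmx b *m ctrmx a.
Proof. by rewrite /ctrmx trmx_mul map_mxM. Qed.

Lemma ctrmxK m n (a : 'M[R[i]]_(m, n)) : ctrmx (ctrmx a) = a.
Proof. by apply/matrixP => i j; rewrite !mxE conjcK. Qed.

Lemma ctrmxD m n (a b : 'M[R[i]]_(m, n)) : ctrmx (a + b) = ctrmx a + ctrmx b.
Proof. by apply/matrixP => i j; rewrite !mxE rmorphD. Qed.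

Lemma ctrmxZ m n (c : R[i]) (a : 'M[R[i]]_(m, n)) :
  ctrmx (c *: a) = conjc c *: ctrmx a.
Proof. by apply/matrixP => i j; rewrite !mxE rmorphM. Qed.

Lemma ctrmx1 n : ctrmx (1%:M : 'M[R[i]]_n) = 1%:M.
Proof. by rewrite /ctrmx trmx1 map_mx1. Qed.

(** The squared norm of [y], seen in [R[i]], is the only entry of [y^* y]; in the product for [a x]
    the factor [a^* a] cancels. *)
Lemma l2norm_isometry m n (a : 'M[R[i]]_(m, n)) (x : 'cV_n) :
  ctrmx a *m a = 1%:M -> l2norm (a *m x) = l2norm x.
Proof.
move=> aa; have sqE p (y : 'cV[R[i]]_p) :
    (\sum_(i < p) (complex.Re (y i 0) ^+ 2 + complex.Im (y i 0) ^+ 2))%:C =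
    (ctrmx y *m y) 0 0.
  rewrite rmorph_sum mxE; apply: eq_bigr => i _.
  by rewrite !mxE conjc_mul_self.
rewrite /l2norm; congr Num.sqrt.
apply: (@complexI R); rewrite !sqE ctrmx_mul.
by rewrite -mulmxA (mulmxA (ctrmx a)) aa mul1mx.
Qed.

Lemma opnorm_isometry_le1 m n (a : 'M[R[i]]_(m, n)) :
  ctrmx a *m a = 1%:M -> opnorm a <= 1.
Proof.
move=> aa; apply: ge_sup.
  (* Bounding a supremum requires a nonempty set: the zero vector lies in the unit ball. *)
  exists (l2norm (a *m 0)), 0 => //=.
  rewrite /l2norm big1 ?sqrtr0 // => i _.
  by rewrite mxE /= expr0n addr0.
by move=> _ [x /= xle1 <-]; rewrite l2norm_isometry.
Qed.

End ScalarMatrices.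

Section ModuleMatrices.
Context {R : realType} {V : lmodType R[i]}.

Lemma scalemxlA m n p q (a : 'M[R[i]]_(m, n)) (b : 'M_(n, p))
    (v : 'M[V]_(p, q)) :
  scalemxl (a *m b) v = scalemxl a (scalemxl b v).
Proof.
apply/matrixP => i j; rewrite !mxE.
under eq_bigr do rewrite mxE scaler_suml.
rewrite exchange_big; apply: eq_bigr => k _ /=.
by rewrite mxE scaler_sumr; apply: eq_bigr => l _; rewrite scalerA.
Qed.

Lemma scalemxrA m n p q (v : 'M[V]_(m, n)) (a : 'M[R[i]]_(n, p))
    (b : 'M_(p, q)) :
  scalemxr v (a *m b) = scalemxr (scalemxr v a) b.
Proof.
apply/matrixP => i j; rewrite !mxE.
under eq_bigr do rewrite mxE scaler_suml.
rewrite exchange_big; apply: eq_bigr => k _ /=.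
rewrite mxE scaler_sumr; apply: eq_bigr => l _.
by rewrite scalerA mulrC.
Qed.

Lemma scalemxlr m n p q (a : 'M[R[i]]_(m, n)) (v : 'M[V]_(n, p))
    (b : 'M_(p, q)) :
  scalemxr (scalemxl a v) b = scalemxl a (scalemxr v b).
Proof.
apply/matrixP => i j; rewrite !mxE.
under eq_bigr do rewrite mxE scaler_sumr.
rewrite exchange_big; apply: eq_bigr => k _ /=.
rewrite mxE scaler_sumr; apply: eq_bigr => l _.
by rewrite !scalerA mulrC.
Qed.

Lemma scalemxlDl m n p (a b : 'M[R[i]]_(m, n)) (v : 'M[V]_(n, p)) :
  scalemxl (a + b) v = scalemxl a v + scalemxl b v.
Proof.
apply/matrixP => i j; rewrite !mxE -big_split.
by apply: eq_bigr => k _; rewrite mxE scalerDl.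
Qed.

Lemma scalemxlDr m n p (a : 'M[R[i]]_(m, n)) (v w : 'M[V]_(n, p)) :
  scalemxl a (v + w) = scalemxl a v + scalemxl a w.
Proof.
apply/matrixP => i j; rewrite !mxE -big_split.
by apply: eq_bigr => k _; rewrite mxE scalerDr.
Qed.

Lemma scalemxrDl m n p (v w : 'M[V]_(m, n)) (b : 'M[R[i]]_(n, p)) :
  scalemxr (v + w) b = scalemxr v b + scalemxr w b.
Proof.
apply/matrixP => i j; rewrite !mxE -big_split.
by apply: eq_bigr => k _; rewrite mxE scalerDr.
Qed.

Lemma scalemxrDr m n p (v : 'M[V]_(m, n)) (a b : 'M[R[i]]_(n, p)) :
  scalemxr v (a + b) = scalemxr v a + scalemxr v b.
Proof.
apply/matrixP => i j; rewrite !mxE -big_split.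
by apply: eq_bigr => k _; rewrite mxE scalerDl.
Qed.

Lemma scalemxl0 m n p (a : 'M[R[i]]_(m, n)) : scalemxl a (0 : 'M[V]_(n, p)) = 0.
Proof.
by apply/matrixP => i j; rewrite !mxE big1 // => k _; rewrite mxE scaler0.
Qed.

Lemma scalemxr0 m n p (b : 'M[R[i]]_(n, p)) : scalemxr (0 : 'M[V]_(m, n)) b = 0.
Proof.
by apply/matrixP => i j; rewrite !mxE big1 // => k _; rewrite mxE scaler0.
Qed.

Lemma scale0mxl m n p (v : 'M[V]_(n, p)) : scalemxl (0 : 'M[R[i]]_(m, n)) v = 0.
Proof.
by apply/matrixP => i j; rewrite !mxE big1 // => k _; rewrite mxE scale0r.
Qed.

Lemma scalemx0r m n p (v : 'M[V]_(m, n)) : scalemxr v (0 : 'M[R[i]]_(n, p)) = 0.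
Proof.
by apply/matrixP => i j; rewrite !mxE big1 // => k _; rewrite mxE scale0r.
Qed.

Lemma scalemxlM m n (c : R[i]) (v : 'M[V]_(m, n)) :
  scalemxl (c%:M) v = map_mx ( *:%R c) v.
Proof.
apply/matrixP => i j; rewrite !mxE (bigD1 i) //= mxE eqxx mulr1n.
by rewrite big1 ?addr0 // => k ki; rewrite mxE eq_sym (negPf ki) scale0r.
Qed.

Lemma scalemxrM m n (c : R[i]) (v : 'M[V]_(m, n)) :
  scalemxr v (c%:M) = map_mx ( *:%R c) v.
Proof.
apply/matrixP => i j; rewrite !mxE (bigD1 j) //= mxE eqxx mulr1n.
by rewrite big1 ?addr0 // => k ki; rewrite mxE (negPf ki) scale0r.
Qed.

Lemma scalemxr_map m n p (c : R[i]) (v : 'M[V]_(m, n)) (b : 'M[R[i]]_(n, p)) :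
  scalemxr (map_mx ( *:%R c) v) b = map_mx ( *:%R c) (scalemxr v b).
Proof. by rewrite -!scalemxlM scalemxlr. Qed.

Lemma scale1mxl m n (v : 'M[V]_(m, n)) : scalemxl 1%:M v = v.
Proof. by rewrite scalemxlM; apply/matrixP => i j; rewrite mxE scale1r. Qed.

Lemma scalemx1r m n (v : 'M[V]_(m, n)) : scalemxr v 1%:M = v.
Proof. by rewrite scalemxrM; apply/matrixP => i j; rewrite mxE scale1r. Qed.

Lemma scalemxl_perm m n (s : 'S_m) (v : 'M[V]_(m, n)) :
  scalemxl (perm_mx s) v = row_perm s v.
Proof.
apply/matrixP => i j; rewrite !mxE (bigD1 (s i)) //= !mxE eqxx scale1r.
by rewrite big1 ?addr0 // => k ki; rewrite !mxE eq_sym (negPf ki) scale0r.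
Qed.

Lemma scalemxr_perm m n (s : 'S_n) (v : 'M[V]_(m, n)) :
  scalemxr v (perm_mx s) = col_perm s^-1 v.
Proof.
apply/matrixP => i j; rewrite !mxE (bigD1 ((s^-1)%g j)) //= !mxE permKV eqxx.
rewrite scale1r big1 ?addr0 // => k ki; rewrite !mxE.
by rewrite -(inj_eq (@perm_inj _ s^-1)) permK (negPf ki) scale0r.
Qed.

Lemma scalemxl_block m1 m2 n1 n2 p1 p2
    (a : 'M[R[i]]_(m1, n1)) b c (d : 'M[R[i]]_(m2, n2))
    (x : 'M[V]_(n1, p1)) y z (w : 'M[V]_(n2, p2)) :
  scalemxl (block_mx a b c d) (block_mx x y z w) =
  block_mx (scalemxl a x + scalemxl b z) (scalemxl a y + scalemxl b w)
           (scalemxl c x + scalemxl d z) (scalemxl c y + scalemxl d w).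
Proof.
apply/matrixP => i j; rewrite mxE big_split_ord.
case: (split_ordP i) => i' ->; case: (split_ordP j) => j' ->;
  rewrite ?(block_mxEul, block_mxEur, block_mxEdl, block_mxEdr) !mxE;
  by congr (_ + _); apply: eq_bigr => k _;
     rewrite ?(block_mxEul, block_mxEur, block_mxEdl, block_mxEdr).
Qed.

Lemma scalemxr_block m1 m2 n1 n2 p1 p2
    (x : 'M[V]_(m1, n1)) y z (w : 'M[V]_(m2, n2))
    (a : 'M[R[i]]_(n1, p1)) b c (d : 'M[R[i]]_(n2, p2)) :
  scalemxr (block_mx x y z w) (block_mx a b c d) =
  block_mx (scalemxr x a + scalemxr y c) (scalemxr x b + scalemxr y d)
           (scalemxr z a + scalemxr w c) (scalemxr z b + scalemxr w d).
Proof.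
apply/matrixP => i j; rewrite mxE big_split_ord.
case: (split_ordP i) => i' ->; case: (split_ordP j) => j' ->;
  rewrite ?(block_mxEul, block_mxEur, block_mxEdl, block_mxEdr) !mxE;
  by congr (_ + _); apply: eq_bigr => k _;
     rewrite ?(block_mxEul, block_mxEur, block_mxEdl, block_mxEdr).
Qed.

Lemma scalemxl_col m1 m2 n p (a : 'M[R[i]]_(m1, n)) (b : 'M_(m2, n))
    (v : 'M[V]_(n, p)) :
  scalemxl (col_mx a b) v = col_mx (scalemxl a v) (scalemxl b v).
Proof.
apply/matrixP => i j; case: (split_ordP i) => i' ->;
  rewrite ?(col_mxEu, col_mxEd) !mxE;
  by apply: eq_bigr => k _; rewrite ?(col_mxEu, col_mxEd).
Qed.

Lemma scalemxr_row m n p1 p2 (v : 'M[V]_(m, n)) (a : 'M[R[i]]_(n, p1))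
    (b : 'M_(n, p2)) :
  scalemxr v (row_mx a b) = row_mx (scalemxr v a) (scalemxr v b).
Proof.
apply/matrixP => i j; case: (split_ordP j) => j' ->;
  rewrite ?(row_mxEl, row_mxEr) !mxE;
  by apply: eq_bigr => k _; rewrite ?(row_mxEl, row_mxEr).
Qed.

Lemma scalemxl_row m n p1 p2 (a : 'M[R[i]]_(m, n)) (v : 'M[V]_(n, p1))
    (w : 'M[V]_(n, p2)) :
  scalemxl a (row_mx v w) = row_mx (scalemxl a v) (scalemxl a w).
Proof.
apply/matrixP => i j; case: (split_ordP j) => j' ->;
  rewrite ?(row_mxEl, row_mxEr) !mxE;
  by apply: eq_bigr => k _; rewrite ?(row_mxEl, row_mxEr).
Qed.

Lemma scalemx_conj_row m n p (v : 'M[V]_n) (a : 'M[R[i]]_(n, m))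
    (b : 'M_(n, p)) :
  scalemxr (scalemxl (ctrmx (row_mx a b)) v) (row_mx a b) =
  block_mx
    (scalemxr (scalemxl (ctrmx a) v) a) (scalemxr (scalemxl (ctrmx a) v) b)
    (scalemxr (scalemxl (ctrmx b) v) a) (scalemxr (scalemxl (ctrmx b) v) b).
Proof.
rewrite /ctrmx tr_row_mx map_col_mx !scalemxlr scalemxr_row scalemxl_col.
by rewrite !scalemxl_row block_mxEv.
Qed.

Lemma rscalemxE m n (k : R) (v : 'M[V]_(m, n)) :
  rscalemx k v = scalemxl (k%:C)%:M v.
Proof. by rewrite scalemxlM. Qed.

Lemma rscalemxDr m n (k : R) (v w : 'M[V]_(m, n)) :
  rscalemx k (v + w) = rscalemx k v + rscalemx k w.
Proof. by rewrite !rscalemxE scalemxlDr. Qed.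

Lemma rscalemxDl m n (k l : R) (v : 'M[V]_(m, n)) :
  rscalemx (k + l) v = rscalemx k v + rscalemx l v.
Proof. by apply/matrixP => i j; rewrite !mxE rmorphD scalerDl. Qed.

Lemma rscalemxA m n (k l : R) (v : 'M[V]_(m, n)) :
  rscalemx k (rscalemx l v) = rscalemx (k * l) v.
Proof. by apply/matrixP => i j; rewrite !mxE scalerA rmorphM. Qed.

Lemma rscale0mx m n (v : 'M[V]_(m, n)) : rscalemx 0 v = 0.
Proof. by apply/matrixP => i j; rewrite !mxE scale0r. Qed.

Lemma rscale1mx m n (v : 'M[V]_(m, n)) : rscalemx 1 v = v.
Proof. by apply/matrixP => i j; rewrite !mxE scale1r. Qed.

Lemma rscalemxN m n (k : R) (v : 'M[V]_(m, n)) :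
  rscalemx (- k) v = - rscalemx k v.
Proof. by apply/matrixP => i j; rewrite !mxE rmorphN scaleNr. Qed.

Lemma rscalemx0 m n (k : R) : rscalemx k (0 : 'M[V]_(m, n)) = 0.
Proof. by apply/matrixP => i j; rewrite !mxE scaler0. Qed.

Lemma rscalemx_block m1 m2 n1 n2 (k : R) (x : 'M[V]_(m1, n1)) y z
    (w : 'M[V]_(m2, n2)) :
  rscalemx k (block_mx x y z w) =
  block_mx (rscalemx k x) (rscalemx k y) (rscalemx k z) (rscalemx k w).
Proof. exact: map_block_mx. Qed.

Lemma scalemxl_rscale m n p (k : R) (a : 'M[R[i]]_(m, n)) (v : 'M[V]_(n, p)) :
  scalemxl a (rscalemx k v) = rscalemx k (scalemxl a v).
Proof. by rewrite !rscalemxE -!scalemxlA scalar_mxC. Qed.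

Lemma scalemxr_rscale m n p (k : R) (v : 'M[V]_(m, n)) (b : 'M[R[i]]_(n, p)) :
  scalemxr (rscalemx k v) b = rscalemx k (scalemxr v b).
Proof. by rewrite !rscalemxE scalemxlr. Qed.

(** This lets a scalar matrix cross the unit [e^n], so that conjugation by a scalar unitary fixes
    [e^n]. *)
Lemma scalemxr_diag (e : V) n p (b : 'M[R[i]]_(n, p)) :
  scalemxr (diagmx e n) b = scalemxl b (diagmx e p).
Proof.
apply/matrixP => i j; rewrite !mxE (bigD1 i) //= (bigD1 j) //= !mxE !eqxx.
by rewrite !big1 // => k ki;
  rewrite mxE ?(negPf ki) 1?eq_sym ?(negPf ki) scaler0.
Qed.

End ModuleMatrices.

(** * The involution on matrices *)

Section StarMatrices.
Context {R : realType} {V : starVectorType R}.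

Lemma starmxK m n (v : 'M[V]_(m, n)) : starmx (starmx v) = v.
Proof. by apply/matrixP => i j; rewrite !mxE starK. Qed.

Lemma starmxD m n (v w : 'M[V]_(m, n)) : starmx (v + w) = starmx v + starmx w.
Proof. by apply/matrixP => i j; rewrite !mxE starD. Qed.

Lemma starmx_scalemxl m n p (a : 'M[R[i]]_(m, n)) (v : 'M[V]_(n, p)) :
  starmx (scalemxl a v) = scalemxr (starmx v) (ctrmx a).
Proof.
apply/matrixP => i j; rewrite !mxE (big_morph star starD star0).
by apply: eq_bigr => k _; rewrite starZ !mxE.
Qed.

Lemma starmx_scalemxr m n p (v : 'M[V]_(m, n)) (b : 'M[R[i]]_(n, p)) :
  starmx (scalemxr v b) = scalemxl (ctrmx b) (starmx v).
Proof.
by rewrite -[v in LHS]starmxK -{1}(ctrmxK b) -starmx_scalemxl starmxK.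
Qed.

Lemma starmx_rscale m n (k : R) (v : 'M[V]_(m, n)) :
  starmx (rscalemx k v) = rscalemx k (starmx v).
Proof. by apply/matrixP => i j; rewrite !mxE starZ conjc_real. Qed.

Lemma starmx_block m1 m2 n1 n2 (x : 'M[V]_(m1, n1)) y z (w : 'M[V]_(m2, n2)) :
  starmx (block_mx x y z w) =
  block_mx (starmx x) (starmx z) (starmx y) (starmx w).
Proof. by rewrite /starmx tr_block_mx map_block_mx. Qed.

Lemma starmx0 m n : starmx (0 : 'M[V]_(m, n)) = 0.
Proof. by apply/matrixP => i j; rewrite !mxE star0. Qed.

End StarMatrices.

(** * Order and unitaries *)

Section Cone.
Context {R : realType} {V : absMatrixOrderUnitType R}.

Lemma mxpos0 n : (0 < n)%N -> mxpos (0 : 'M[V]_n).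
Proof. by move=> n0; exact: (cone_0 (mxpos_cone n n0)). Qed.

Lemma mxposD n (u v : 'M[V]_n) : (0 < n)%N ->
  mxpos u -> mxpos v -> mxpos (u + v).
Proof. by move=> n0; exact: (cone_add (mxpos_cone n n0)). Qed.

Lemma mxpos_rscale n (k : R) (v : 'M[V]_n) :
  (0 < n)%N -> 0 <= k -> mxpos v -> mxpos (rscalemx k v).
Proof. by move=> n0; exact: (cone_scale (mxpos_cone n n0)). Qed.

Lemma mxpos_selfadj n (v : 'M[V]_n) : (0 < n)%N -> mxpos v -> starmx v = v.
Proof. by move=> n0; exact: (cone_sub (mxpos_cone n n0)). Qed.

Lemma absmx_mxpos n (v : 'M[V]_n) : (0 < n)%N -> mxpos v -> absmx v = v.
Proof. by move=> n0; exact: (abs_cone (absmx_ordered n n0)). Qed.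

(* [|-v| = |v|] forces properness of the cone: if [v, -v >= 0] then [-v = v]. *)
Lemma mxpos_proper n (v : 'M[V]_n) :
  (0 < n)%N -> mxpos v -> mxpos (- v) -> v = 0.
Proof.
move=> n0 v_pos Nv_pos.
have := abs_scale (absmx_ordered n n0) (-1) (mxpos_selfadj n0 v_pos).
rewrite rscalemxN rscale1mx normrN1 rscale1mx !absmx_mxpos // => vE.
apply/matrixP => i j; rewrite mxE; apply/eqP.
have /eqP := congr1 (fun A : 'M[V]_n => A i j) vE; rewrite !mxE.
rewrite -subr_eq0 -opprD oppr_eq0 -mulr2n -scaler_nat scaler_eq0.
by rewrite pnatr_eq0.
Qed.

Lemma lemx_refl n (u : 'M[V]_n) : (0 < n)%N -> lemx u u.
Proof. by move=> n0; rewrite /lemx /le_cone subrr; exact: mxpos0. Qed.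

Lemma lemx_trans n (u v w : 'M[V]_n) :
  (0 < n)%N -> lemx u v -> lemx v w -> lemx u w.
Proof.
move=> n0 uv vw; rewrite /lemx /le_cone.
have -> : w - u = (w - v) + (v - u) by rewrite addrA subrK.
exact: mxposD.
Qed.

Lemma lemx_anti n (u v : 'M[V]_n) : (0 < n)%N -> lemx u v -> lemx v u -> u = v.
Proof.
move=> n0 uv vu; apply/esym/eqP; rewrite -subr_eq0; apply/eqP.
by apply: mxpos_proper => //; rewrite opprB.
Qed.

Lemma lemx_rscale n (k l : R) (v : 'M[V]_n) :
  (0 < n)%N -> mxpos v -> k <= l -> lemx (rscalemx k v) (rscalemx l v).
Proof.
move=> n0 v_pos kl; rewrite /lemx /le_cone -rscalemxN -rscalemxDl.
by apply: mxpos_rscale => //; rewrite subr_ge0.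
Qed.

Lemma lemx_conj m n (u v : 'M[V]_n) (a : 'M[R[i]]_(n, m)) :
  (0 < m)%N -> (0 < n)%N -> lemx u v ->
  lemx (scalemxr (scalemxl (ctrmx a) u) a) (scalemxr (scalemxl (ctrmx a) v) a).
Proof.
move=> m0 n0 uv; have := mxpos_conj _ _ a _ m0 n0 uv.
rewrite scalemxlDr scalemxrDl.
suff -> : scalemxr (scalemxl (ctrmx a) (- u)) a =
          - scalemxr (scalemxl (ctrmx a) u) a by [].
by rewrite -[u]rscale1mx -rscalemxN scalemxl_rscale scalemxr_rscale
           rscalemxN !rscale1mx.
Qed.

Lemma is_unitary_unitmx n : (0 < n)%N -> is_unitary (unitmx_of V n).
Proof.
case: n => // n _; elim: n => [|n IHn]; first exact: is_unitary_unit.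
rewrite /unitmx_of -[n.+2]add1n diagmxD.
exact: (is_unitary_dsum _ _ is_unitary_unit IHn).
Qed.

(** Absolute values are positive, and the unit is its own absolute value. *)
Lemma mxpos_unitmx n : (0 < n)%N -> mxpos (unitmx_of V n).
Proof. by move=> n0; rewrite -(is_unitary_unitmx n0).1; exact: absmx_pos. Qed.

Lemma is_unitary_star n (u : 'M[V]_n) : is_unitary u -> is_unitary (starmx u).
Proof. by case=> u1 u2; split; rewrite ?starmxK. Qed.

(** The axiom on [|a v b|] with [b = 1] bounds [|a v|] by [|v|] times the norm of [a], which is at
    most 1 for an isometry. *)
Lemma absmx_scalel_le m n (a : 'M[R[i]]_m) (v : 'M[V]_(m, n)) :
  (0 < m)%N -> (0 < n)%N -> ctrmx a *m a = 1%:M ->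
  lemx (absmx (scalemxl a v)) (absmx v).
Proof.
move=> m0 n0 aa; have v_pos := absmx_pos _ _ v m0 n0.
have := absmx_le _ _ _ _ a v 1%:M m0 n0 m0 n0.
rewrite !scalemx1r (absmx_mxpos n0 v_pos) => le_av.
apply: (lemx_trans n0 le_av); rewrite -[X in lemx _ X]rscale1mx.
by apply: lemx_rscale => //; exact: opnorm_isometry_le1.
Qed.

(** The preceding inequality is used for [a] on [v] and for [a^*] on [a v]; since [a] is square,
    [a^*] is an isometry too. *)
Lemma absmx_scalel m n (a : 'M[R[i]]_m) (v : 'M[V]_(m, n)) :
  (0 < m)%N -> (0 < n)%N -> ctrmx a *m a = 1%:M ->
  absmx (scalemxl a v) = absmx v.
Proof.
move=> m0 n0 aa; apply: lemx_anti => //; first exact: absmx_scalel_le.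
have aa' : ctrmx (ctrmx a) *m ctrmx a = 1%:M by rewrite ctrmxK; exact: mulmx1C.
have := absmx_scalel_le (scalemxl a v) m0 n0 aa'.
by rewrite -scalemxlA aa scale1mxl.
Qed.

(** Upper bound: [|w b|] is below [| |w| b | = |e b| = |b e| = e]. Lower bound: with [x = |w b|],
    [e = |w b b^*|] is below [|x b^*| = |b x b^*| = b x b^*], and conjugating by [b] puts [e] below
    [x]. *)
Lemma absmx_unit_scaler n (w : 'M[V]_n) (b : 'M[R[i]]_n) :
  (0 < n)%N -> ctrmx b *m b = 1%:M -> absmx w = unitmx_of V n ->
  absmx (scalemxr w b) = unitmx_of V n.
Proof.
move=> n0 bb w1; have bb' : b *m ctrmx b = 1%:M by exact: mulmx1C.
have lew (c : 'M[R[i]]_n) (x : 'M[V]_n) :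
    lemx (absmx (scalemxr x c)) (absmx (scalemxr (absmx x) c)).
  have := absmx_le _ _ _ _ 1%:M x c n0 n0 n0 n0; rewrite scale1mxl => le_x.
  apply: (lemx_trans n0 le_x); rewrite -[X in lemx _ X]rscale1mx.
  apply: lemx_rscale => //; first exact: absmx_pos.
  by apply: opnorm_isometry_le1; rewrite ctrmx1 mul1mx.
have e1 := (is_unitary_unitmx n0).1.
apply: lemx_anti => //.
  have := lew b w; rewrite w1 /unitmx_of scalemxr_diag.
  by rewrite absmx_scalel // e1.
set x := absmx (scalemxr w b); have x_pos : mxpos x by exact: absmx_pos.
have le_e : lemx (unitmx_of V n) (scalemxr (scalemxl b x) (ctrmx b)).
  have := lew (ctrmx b) (scalemxr w b).
  rewrite -scalemxrA bb' scalemx1r w1.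
  rewrite -(@absmx_scalel _ _ b (scalemxr (absmx _) _)) //.
  rewrite -scalemxlr absmx_mxpos //.
  by have := @mxpos_conj _ _ _ _ (ctrmx b) _ n0 n0 x_pos; rewrite ctrmxK.
have := lemx_conj b n0 n0 le_e.
rewrite -!scalemxlr -!scalemxlA bb scale1mxl -!scalemxrA bb scalemx1r.
by rewrite /unitmx_of scalemxlr scalemxr_diag -scalemxlA bb scale1mxl.
Qed.

Lemma is_unitary_scalel n (a : 'M[R[i]]_n) (w : 'M[V]_n) :
  (0 < n)%N -> ctrmx a *m a = 1%:M -> is_unitary w -> is_unitary (scalemxl a w).
Proof.
move=> n0 aa [w1 w2]; split; first by rewrite absmx_scalel.
rewrite starmx_scalemxl; apply: absmx_unit_scaler => //.
by rewrite ctrmxK; exact: mulmx1C.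
Qed.

(** Taking adjoints turns right multiplication into left multiplication. *)
Lemma is_unitary_scaler n (w : 'M[V]_n) (b : 'M[R[i]]_n) :
  (0 < n)%N -> ctrmx b *m b = 1%:M -> is_unitary w -> is_unitary (scalemxr w b).
Proof.
move=> n0 bb w1; rewrite -[w]starmxK -[b]ctrmxK -starmx_scalemxl.
apply/is_unitary_star/is_unitary_scalel => //; last exact: is_unitary_star.
by rewrite ctrmxK; exact: mulmx1C.
Qed.

End Cone.

(** * Norm bounds *)

Section BoundedMatrices.
Context {R : realType} {V : absMatrixOrderUnitType R}.

(* [mxbd k v] says that [k] belongs to the set whose infimum is [mxnorm v],
   except that [k] may also be [0]. *)
Definition mxbd (k : R) n (v : 'M[V]_n) : Prop :=
  mxpos (block_mx (rscalemx k (unitmx_of V n)) v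
                  (starmx v) (rscalemx k (unitmx_of V n))).

Lemma mxbd0 n : (0 < n)%N -> mxbd 0 (0 : 'M[V]_n).
Proof.
move=> n0; rewrite /mxbd starmx0 rscale0mx block_mx0.
by apply: mxpos0; rewrite addn_gt0 n0.
Qed.

Lemma mxbdD n (k l : R) (v w : 'M[V]_n) : (0 < n)%N ->
  mxbd k v -> mxbd l w -> mxbd (k + l) (v + w).
Proof.
move=> n0 kv lw; rewrite /mxbd starmxD rscalemxDl -add_block_mx.
by apply: mxposD => //; rewrite addn_gt0 n0.
Qed.

Lemma mxpos_unit_block n (k : R) : (0 < n)%N -> 0 <= k ->
  mxpos (block_mx (rscalemx k (unitmx_of V n)) 0
                  0 (rscalemx k (unitmx_of V n))).
Proof.
move=> n0 k0; rewrite -(@rscalemx0 _ V n n k) -rscalemx_block.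
rewrite -[block_mx _ _ _ _]/(dsummx _ _) -diagmxD.
by apply: mxpos_rscale => //; [|apply: mxpos_unitmx]; rewrite addn_gt0 n0.
Qed.

Lemma mxbd_le n (k l : R) (v : 'M[V]_n) : (0 < n)%N -> k <= l ->
  mxbd k v -> mxbd l v.
Proof.
(* The slack [l - k] is a bound for the zero matrix. *)
move=> n0 kl kv; rewrite -[v]add0r -[l](subrK k); apply: mxbdD => //.
by rewrite /mxbd starmx0; apply: mxpos_unit_block; rewrite ?subr_ge0.
Qed.

Lemma mxbd_rscale n (k l : R) (v : 'M[V]_n) : (0 < n)%N -> 0 <= l ->
  mxbd k v -> mxbd (l * k) (rscalemx l v).
Proof.
move=> n0 l0 kv; rewrite /mxbd starmx_rscale -rscalemxA -rscalemx_block.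
by apply: mxpos_rscale => //; rewrite addn_gt0 n0.
Qed.

(* Conjugating the block matrix by [a + b], for contractions [a] and [b]. *)
Lemma mxbd_conj m n (k : R) (v : 'M[V]_n) (a b : 'M[R[i]]_(n, m)) :
  (0 < m)%N -> (0 < n)%N -> 0 <= k ->
  lemx (scalemxr (scalemxl (ctrmx a) (unitmx_of V n)) a) (unitmx_of V m) ->
  lemx (scalemxr (scalemxl (ctrmx b) (unitmx_of V n)) b) (unitmx_of V m) ->
  mxbd k v -> mxbd k (scalemxr (scalemxl (ctrmx a) v) b).
Proof.
move=> m0 n0 k0 ale ble kv.
have mm0 : (0 < m + m)%N by rewrite addn_gt0 m0.
have nn0 : (0 < n + n)%N by rewrite addn_gt0 n0.
pose c : 'M[R[i]]_(n + n, m + m) := block_mx a 0 0 b.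
have cE : ctrmx c = block_mx (ctrmx a) 0 0 (ctrmx b).
  by rewrite /ctrmx tr_block_mx map_block_mx !trmx0 !map_mx0.
have := @mxpos_conj _ _ _ _ c _ mm0 nn0 kv.
rewrite cE scalemxl_block scalemxr_block.
rewrite !(scale0mxl, scalemx0r, addr0, add0r) !scalemxl_rscale !scalemxr_rscale.
set x := scalemxr _ a; set y := scalemxr (scalemxl _ v) _.
set z := scalemxr (scalemxl _ (starmx v)) _; set w := scalemxr _ b => pos1.
have yz : starmx y = z.
  by rewrite starmx_scalemxr starmx_scalemxl ctrmxK -scalemxlr.
(* Conjugation leaves diagonal blocks that are only below [k e]; [pos2] is what must be added to
   them. It is positive because a direct sum of positive matrices is its own absolute value. *)
have pos2 :
    mxpos (rscalemx k (block_mx (unitmx_of V m - x) 0 0 (unitmx_of V m - w))).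
  apply: mxpos_rscale => //.
  have p1 := absmx_mxpos m0 ale; have p2 := absmx_mxpos m0 ble.
  rewrite -[block_mx _ _ _ _]/(dsummx _ _) -p1 -p2 -absmx_dsum //.
  exact: absmx_pos.
have := mxposD mm0 pos1 pos2.
rewrite rscalemx_block add_block_mx !rscalemx0 !addr0.
by rewrite -!rscalemxDr !(addrC x) !(addrC w) !subrK /mxbd yz.
Qed.

Lemma mxbdN n (k : R) (v : 'M[V]_n) : (0 < n)%N -> 0 <= k ->
  mxbd k v -> mxbd k (- v).
Proof.
move=> n0 k0 kv.
(* Conjugation by [-1] and [1] changes the sign of the off-diagonal blocks only. *)
have := @mxbd_conj n n k v (-1)%:M 1%:M n0 n0 k0.
have -> : ctrmx (-1)%:M = (-1)%:M :> 'M[R[i]]_n.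
  by rewrite /ctrmx tr_scalar_mx map_scalar_mx rmorphN1.
have Nx (x : 'M[V]_n) : scalemxl (-1)%:M x = - x.
  by rewrite scalemxlM; apply/matrixP => i j; rewrite !mxE scaleN1r.
have xN (x : 'M[V]_n) : scalemxr x (-1)%:M = - x.
  by rewrite scalemxrM; apply/matrixP => i j; rewrite !mxE scaleN1r.
rewrite ctrmx1 !scalemx1r !scale1mxl !Nx xN opprK => /(_ (lemx_refl _ n0)).
by apply=> //; exact: lemx_refl.
Qed.

Lemma mxbd_rscale_norm n (k l : R) (v : 'M[V]_n) : (0 < n)%N -> 0 <= k ->
  mxbd k v -> mxbd (`|l| * k) (rscalemx l v).
Proof.
move=> n0 k0 kv; case: (ger0P l) => l0; first by exact: mxbd_rscale.
rewrite -[l in rscalemx l]opprK rscalemxN; apply: mxbdN => //.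
  by rewrite mulr_ge0 // oppr_ge0 ltW.
by apply: mxbd_rscale => //; rewrite oppr_ge0 ltW.
Qed.

(* The self-adjoint matrix with off-diagonal blocks [u] and [u^*] is the flip
   applied to [u^* + u], so its absolute value is a multiple of the unit. *)
Lemma mxbd_unitary n (u : 'M[V]_n) : (0 < n)%N -> is_unitary u ->
  exists2 k : R, 0 < k & mxbd k u.
Proof.
move=> n0 [u1 u2]; have nn0 : (0 < n + n)%N by rewrite addn_gt0 n0.
pose p : 'M[R[i]]_(n + n) := block_mx 0 1%:M 1%:M 0.
pose d := dsummx (starmx u) u; pose b := block_mx 0 u (starmx u) 0.
have e_pos : mxpos (unitmx_of V (n + n)) by exact: mxpos_unitmx.
have dE : absmx d = unitmx_of V (n + n) by rewrite absmx_dsum // u1 u2 -diagmxD.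
have bE : scalemxl p d = b.
  by rewrite scalemxl_block !(scalemxl0, scale0mxl, scale1mxl, addr0, add0r).
have b_sa : selfadj b by rewrite /selfadj /= starmx_block starmxK !starmx0.
(* Any positive bound will do; the maximum with 1 avoids computing the norm of the flip. *)
pose k := Num.max 1 (opnorm p); exists k; first by rewrite lt_max ltr01.
have b_le : lemx (absmx b) (rscalemx k (unitmx_of V (n + n))).
  have := absmx_le _ _ _ _ p d 1%:M nn0 nn0 nn0 nn0.
  rewrite !scalemx1r bE dE (absmx_mxpos nn0 e_pos) => le_b.
  apply: (lemx_trans nn0 le_b); apply: lemx_rscale => //.
  by rewrite le_max lexx orbT.
(* Adding [|b| + b >= 0] to [k e - |b| >= 0] gives [k e + b >= 0], the required block matrix. *)
have [b_ge _] := abs_ge (absmx_ordered _ nn0) b_sa.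
have := mxposD nn0 b_le b_ge; rewrite addrA subrK /unitmx_of diagmxD.
by rewrite rscalemx_block add_block_mx !rscalemx0 !add0r !addr0.
Qed.

Lemma mxnorm_le n (k : R) (v : 'M[V]_n) : 0 < k -> mxbd k v -> mxnorm v <= k.
Proof.
by move=> k0 kv; apply: ge_inf => //; exists 0 => l /= [/ltW].
Qed.

(** The infimum of an empty set has the default value 0, so a small [mxnorm] is informative only
    once some bound [k] is known. *)
Lemma mxbd_norm n (k eps : R) (v : 'M[V]_n) : (0 < n)%N ->
  0 < k -> mxbd k v -> mxnorm v < eps -> mxbd eps v.
Proof.
move=> n0 k0 kv; have ne : [set l : R | 0 < l /\ mxbd l v] !=set0 by exists k.
by move=> /(inf_lt ne) [l /= [_ lv] /ltW leps]; exact: mxbd_le lv.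
Qed.

Lemma ctrmx0 m n : ctrmx (0 : 'M[R[i]]_(m, n)) = 0.
Proof. by apply/matrixP => i j; rewrite !mxE conjc0. Qed.

(** Written as a conjugation, padding by zeros falls under [mxpos_conj] and [mxbd_conj]. *)
Lemma dsummx0E m n (v : 'M[V]_n) :
  dsummx v (0 : 'M_m) =
  scalemxr (scalemxl (ctrmx (row_mx 1%:M (0 : 'M[R[i]]_(n, m)))) v)
    (row_mx 1%:M 0).
Proof.
rewrite scalemx_conj_row ctrmx1 ctrmx0.
by rewrite !(scale1mxl, scalemx1r, scale0mxl, scalemx0r, scalemxr0).
Qed.

Lemma dsum0mxE m n (v : 'M[V]_n) :
  dsummx (0 : 'M_m) v =
  scalemxr (scalemxl (ctrmx (row_mx (0 : 'M[R[i]]_(n, m)) 1%:M)) v)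
    (row_mx 0 1%:M).
Proof.
rewrite scalemx_conj_row ctrmx1 ctrmx0.
by rewrite !(scale1mxl, scalemx1r, scale0mxl, scalemx0r, scalemxr0).
Qed.

Lemma mxbd_dsummx0 m n (k : R) (v : 'M[V]_n) :
  (0 < m)%N -> (0 < n)%N -> 0 <= k ->
  mxbd k v -> mxbd k (dsummx v (0 : 'M_m)).
Proof.
move=> m0 n0 k0 kv; have nm0 : (0 < n + m)%N by rewrite addn_gt0 n0.
(* The difference is the padded unit [0 + e^m], again a conjugate of a unit. *)
have e_le : lemx (dsummx (unitmx_of V n) (0 : 'M_m)) (unitmx_of V (n + m)).
  rewrite /lemx /le_cone /unitmx_of diagmxD opp_block_mx add_block_mx.
  rewrite !subrr ?oppr0.
  rewrite ?addr0 -[block_mx _ _ _ _]/(dsummx _ _) dsum0mxE.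
  by apply: mxpos_conj => //; exact: mxpos_unitmx.
by rewrite dsummx0E; apply: mxbd_conj; rewrite -?dsummx0E.
Qed.

Lemma mxbd_dsum0mx m n (k : R) (v : 'M[V]_n) :
  (0 < m)%N -> (0 < n)%N -> 0 <= k ->
  mxbd k v -> mxbd k (dsummx (0 : 'M_m) v).
Proof.
move=> m0 n0 k0 kv; have nm0 : (0 < m + n)%N by rewrite addn_gt0 m0.
have e_le : lemx (dsummx (0 : 'M_m) (unitmx_of V n)) (unitmx_of V (m + n)).
  rewrite /lemx /le_cone /unitmx_of diagmxD opp_block_mx add_block_mx.
  rewrite !subrr ?oppr0.
  rewrite ?addr0 -[block_mx _ _ _ _]/(dsummx _ _) dsummx0E.
  by apply: mxpos_conj => //; exact: mxpos_unitmx.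
by rewrite dsum0mxE; apply: mxbd_conj; rewrite -?dsum0mxE.
Qed.

End BoundedMatrices.

(** * Homotopies of unitaries *)

Section Homotopy.
Context {R : realType} {V : absMatrixOrderUnitType R}.

(** Continuity is put in terms of bounds instead of infima, because bounds pass directly through
    sums, conjugations and morphisms. *)
Definition mxbd_path n (u v : 'M[V]_n) (f : R -> 'M[V]_n) : Prop :=
  [/\ forall t, 0 <= t <= 1 -> is_unitary (f t),
      forall t, 0 <= t <= 1 -> forall eps, 0 < eps ->
        exists2 delta, 0 < delta &
          forall s, 0 <= s <= 1 -> `|s - t| < delta -> mxbd eps (f s - f t),
      f 0 = u & f 1 = v].

(** Along a path of unitaries every difference [f s - f t] has some bound by [mxbd_unitary], so its
    [mxnorm] is a genuine infimum. *)
Lemma homotopicP n (u v : 'M[V]_n) : (0 < n)%N ->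
  homotopic u v <-> exists f, mxbd_path u v f.
Proof.
move=> n0; split=> -[f [fU fc f0 f1]]; exists f; split=> // t t01 eps eps0.
  have [d d0 fd] := fc t t01 eps eps0; exists d => // s s01 std.
  have [k k0 kb] := mxbd_unitary n0 (fU s s01).
  have [l l0 lb] := mxbd_unitary n0 (fU t t01).
  apply: mxbd_norm n0 _ (mxbdD n0 kb (mxbdN n0 (ltW l0) lb)) (fd s s01 std).
  exact: addr_gt0.
(* A bound controls [mxnorm] only weakly; halving [eps] makes the inequality strict. *)
have eps2 : 0 < eps / 2 by rewrite divr_gt0.
have [d d0 fd] := fc t t01 _ eps2; exists d => // s s01 std.
apply: (@le_lt_trans _ _ (eps / 2)); first exact: mxnorm_le (fd s s01 std).
by rewrite ltr_pdivrMr // ltr_pMr // ltr1n.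
Qed.

Lemma homotopic_refl n (u : 'M[V]_n) :
  (0 < n)%N -> is_unitary u -> homotopic u u.
Proof.
move=> n0 u1; apply/homotopicP => //; exists (fun=> u); split=> // t _ eps eps0.
by exists 1 => // s _ _; rewrite subrr; apply: mxbd_le (ltW eps0) (mxbd0 n0).
Qed.

Lemma homotopic_sym n (u v : 'M[V]_n) : homotopic u v -> homotopic v u.
Proof.
case=> f [fU fc f0 f1]; have rev01 (t : R) : 0 <= t <= 1 -> 0 <= 1 - t <= 1.
  by move=> t01; lra.
exists (fun t => f (1 - t)); split; rewrite ?subr0 ?subrr //.
  by move=> t /rev01; exact: fU.
move=> t t01 eps eps0; have [d d0 fd] := fc _ (rev01 t t01) eps eps0.
exists d => // s s01 std; apply: fd; first exact: rev01.
by rewrite opprB addrC addrA subrK distrC.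
Qed.

Lemma homotopic_trans n (u v w : 'M[V]_n) :
  homotopic u v -> homotopic v w -> homotopic u w.
Proof.
case=> f [fU fc f0 f1] [g [gU gc g0 g1]].
exists (fun t => if t <= 1 / 2 then f (2 * t) else g (2 * t - 1)); split.
- by move=> t t01; case: leP => t2; [apply: fU | apply: gU]; lra.
- move=> t t01 eps eps0 /=.
  have fT (s0 : R) : 0 <= s0 <= 1 / 2 -> 0 <= 2 * s0 <= 1 by move=> ?; lra.
  have gT (s0 : R) : 1 / 2 <= s0 <= 1 -> 0 <= 2 * s0 - 1 <= 1 by move=> ?; lra.
  case: (ltgtP t (1 / 2)) => t2.
  + have [d d0 fd] := fc (2 * t) (fT t ltac:(lra)) eps eps0.
    (* Half of [d] compensates for the doubled speed; the other term keeps [s] on the same side of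
       [1 / 2] as [t]. *)
    exists (Num.min (d / 2) (1 / 2 - t)); first by rewrite lt_min; lra.
    move=> s s01; rewrite lt_min => /andP[sd]; rewrite ltr_norml => /andP[_ s2].
    have -> : (s <= 1 / 2) = true by apply/idP; lra.
    by apply: fd; first lra; rewrite -mulrBr normrM ger0_norm //; lra.
  + have [d d0 gd] := gc (2 * t - 1) (gT t ltac:(lra)) eps eps0.
    exists (Num.min (d / 2) (t - 1 / 2)); first by rewrite lt_min; lra.
    move=> s s01; rewrite lt_min => /andP[sd]; rewrite ltr_norml => /andP[s2 _].
    have -> : (s <= 1 / 2) = false by apply/negbTE; rewrite -ltNge; lra.
    apply: gd; first lra.
    have -> : 2 * s - 1 - (2 * t - 1) = 2 * (s - t) by ring.
    by rewrite normrM ger0_norm //; lra.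
  + have [d d0 fd] := fc (2 * t) (fT t ltac:(lra)) eps eps0.
    have [d' d'0 gd] := gc (2 * t - 1) (gT t ltac:(lra)) eps eps0.
    exists (Num.min (d / 2) (d' / 2)); first by rewrite lt_min; lra.
    move=> s s01; rewrite lt_min => /andP[sd sd'].
    case: (leP s (1 / 2)) => s2.
      by apply: fd; first lra; rewrite -mulrBr normrM ger0_norm //; lra.
    (* At [t = 1 / 2] both pieces take the value [v], so points on the right may be compared through
       [g]. *)
    have -> : f (2 * t) = g (2 * t - 1).
      have -> : 2 * t = 1 by lra.
      by rewrite subrr f1 g0.
    apply: gd; first lra.
    have -> : 2 * s - 1 - (2 * t - 1) = 2 * (s - t) by ring.
    by rewrite normrM ger0_norm //; lra.
- by rewrite mulr0 ifT // divr_ge0.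
- have -> : (1 <= 1 / 2 :> R) = false by apply/negbTE; rewrite -ltNge; lra.
  by have -> : 2 * 1 - 1 = 1 :> R by ring.
Qed.

Lemma dsummxB m n (u u' : 'M[V]_m) (v v' : 'M[V]_n) :
  dsummx u v - dsummx u' v' = dsummx (u - u') (v - v').
Proof. by rewrite opp_block_mx add_block_mx !subr0. Qed.

Lemma homotopic_dsuml m n (u v : 'M[V]_m) (w : 'M[V]_n) :
  (0 < m)%N -> (0 < n)%N -> is_unitary w ->
  homotopic u v -> homotopic (dsummx u w) (dsummx v w).
Proof.
move=> m0 n0 w1 /(homotopicP _ _ m0)[f [fU fc f0 f1]].
apply/homotopicP; first by rewrite addn_gt0 m0.
exists (fun t => dsummx (f t) w); rewrite /mxbd_path f0 f1; split=> //.
  by move=> t t01; apply: is_unitary_dsum => //; exact: fU.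
move=> t t01 eps eps0; have [d d0 fd] := fc t t01 eps eps0.
exists d => // s s01 std; rewrite dsummxB subrr.
by apply: mxbd_dsummx0 (ltW eps0) (fd s s01 std).
Qed.

Lemma homotopic_dsumr m n (u v : 'M[V]_n) (w : 'M[V]_m) :
  (0 < m)%N -> (0 < n)%N -> is_unitary w ->
  homotopic u v -> homotopic (dsummx w u) (dsummx w v).
Proof.
move=> m0 n0 w1 /(homotopicP _ _ n0)[f [fU fc f0 f1]].
apply/homotopicP; first by rewrite addn_gt0 m0.
exists (fun t => dsummx w (f t)); rewrite /mxbd_path f0 f1; split=> //.
  by move=> t t01; apply: is_unitary_dsum => //; exact: fU.
move=> t t01 eps eps0; have [d d0 fd] := fc t t01 eps eps0.
exists d => // s s01 std; rewrite dsummxB subrr.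
by apply: mxbd_dsum0mx (ltW eps0) (fd s s01 std).
Qed.

(* Conjugating [w] by the scalar unitary [c + i s S], for a self-adjoint
   unitary [S]. *)
Definition rotmx n (S : 'M[R[i]]_n) (w : 'M[V]_n) (c s : R) : 'M[V]_n :=
  rscalemx (c ^+ 2) w + rscalemx (s ^+ 2) (scalemxr (scalemxl S w) S) +
  rscalemx (c * s) (scalemxl ('i%:M *m S) w - scalemxr (scalemxl 'i%:M w) S).

(** For [a = c + i s S] the cross terms of [a^* a] cancel and leave [c^2 + s^2 = 1]; expanding
    [a w a^*] gives [rotmx S w c s]. *)
Lemma is_unitary_rotmx n (c s : R) (S : 'M[R[i]]_n) (w : 'M[V]_n) :
  (0 < n)%N -> ctrmx S = S -> S *m S = 1%:M -> c ^+ 2 + s ^+ 2 = 1 ->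
  is_unitary w -> is_unitary (rotmx S w c s).
Proof.
move=> n0 SC SS cs w1; pose x : R[i] := 'i * s%:C.
pose a : 'M[R[i]]_n := c%:C *: 1%:M + x *: S.
have xC : conjc x = - x by rewrite /x; simpc.
have xx : x * x = - (s ^+ 2)%:C.
  by rewrite /x mulrACA -expr2 sqr_i -rmorphM mulN1r expr2.
have aC : ctrmx a = c%:C *: 1%:M - x *: S.
  by rewrite ctrmxD !ctrmxZ ctrmx1 SC xC scaleNr conjc_real.
have aa : ctrmx a *m a = 1%:M.
  rewrite aC /a mulmxBl !mulmxDr -!scalemxAl -!scalemxAr !mulmx1 !mul1mx SS.
  rewrite !scalerA opprD [- _ - _]addrC addrACA (mulrC x c%:C) subrr.
  rewrite addr0 xx -scalerBl opprK.
  by rewrite -rmorphM -rmorphD -expr2 cs scale1r.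
suff -> : rotmx S w c s = scalemxr (scalemxl a w) (ctrmx a).
  apply: is_unitary_scaler; rewrite ?ctrmxK //; first exact: mulmx1C.
  exact: is_unitary_scalel.
rewrite aC /a scalemxlDl scalemxrDr -scaleNr !scalemxrDl.
rewrite -!mul_scalar_mx !scalemxlA !scalemxrA !scale1mxl !scalemx1r.
rewrite /rotmx scalemxlA; set y := scalemxl S w; set z := scalemxr y S.
set z' := scalemxr w S.
have -> : scalemxr (scalemxl 'i%:M w) S = scalemxl 'i%:M z'.
  by rewrite scalemxlr.
rewrite !scalemxrM !scalemxlM !scalemxr_map -/y -/z -/z'.
clearbody y z z'; apply/matrixP => i j; rewrite !mxE !scalerA scalerBr !scalerA.
rewrite !mulNr xx opprK -!rmorphM !scaleNr -!expr2 -!addrA; congr (_ + _).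
rewrite [RHS]addrA [RHS]addrC; congr (_ + (_ - _)); congr (_ *: _).
  by rewrite /x rmorphM mulrCA mulrA; ring.
by rewrite /x rmorphM; ring.
Qed.

(** For the roots [y <= x], squaring reduces this to [(x - y)^2 <= x^2 - y^2]. *)
Lemma sqrt_dist (a b : R) : 0 <= a -> 0 <= b ->
  `|Num.sqrt a - Num.sqrt b| <= Num.sqrt `|a - b|.
Proof.
wlog le_ba : a b / b <= a => [IH|] a0 b0.
  case: (leP b a) => [|/ltW] ab; first exact: IH.
  by rewrite distrC (distrC a); exact: IH.
rewrite !ger0_norm ?subr_ge0 ?ler_sqrt //.
rewrite -(@ler_pXn2r _ 2) ?nnegrE ?subr_ge0 ?ler_sqrt ?sqrtr_ge0 //.
rewrite sqr_sqrtr ?subr_ge0 //.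
have yx : Num.sqrt b <= Num.sqrt a by rewrite ler_sqrt.
have aE := sqr_sqrtr a0; have bE := sqr_sqrtr b0; have y0 := sqrtr_ge0 b.
by rewrite -[X in _ <= X - _]aE -[X in _ <= _ - X]bE; nra.
Qed.

(** Along the path [w], [S w S] and [i (S w - w S)] have the coefficients [1 - t], [t] and
    [sqrt ((1 - t) t)]. The last is not Lipschitz at the ends, but all three vary by at most
    [sqrt |s - t|], and the three matrices are bounded. *)
Lemma homotopic_conj_involution n (S : 'M[R[i]]_n) (w : 'M[V]_n) :
  (0 < n)%N -> ctrmx S = S -> S *m S = 1%:M -> is_unitary w ->
  homotopic w (scalemxr (scalemxl S w) S).
Proof.
move=> n0 SC SS w1; have SU : ctrmx S *m S = 1%:M by rewrite SC.
have iU : ctrmx ('i%:M : 'M[R[i]]_n) *m 'i%:M = 1%:M.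
  rewrite /ctrmx tr_scalar_mx map_scalar_mx -scalar_mxM /=.
  by simpc.
pose x := scalemxr (scalemxl S w) S.
pose y := scalemxl ('i%:M *m S) w - scalemxr (scalemxl 'i%:M w) S.
have xU : is_unitary x.
  by apply: is_unitary_scaler => //; exact: is_unitary_scalel.
have [k k0 kw] := mxbd_unitary n0 w1; have [l l0 lx] := mxbd_unitary n0 xU.
(* [y] is not unitary, but it is a difference of two unitaries. *)
have [m m0 my] : exists2 m : R, 0 < m & mxbd m y.
  have y1 : is_unitary (scalemxl ('i%:M *m S) w).
    rewrite scalemxlA; do 2!apply: is_unitary_scalel => //.
  have y2 : is_unitary (scalemxr (scalemxl 'i%:M w) S).
    by apply: is_unitary_scaler => //; exact: is_unitary_scalel.
  have [p p0 pb] := mxbd_unitary n0 y1; have [q q0 qb] := mxbd_unitary n0 y2.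
  exists (p + q); first exact: addr_gt0.
  by apply: mxbdD => //; apply: mxbdN => //; exact: ltW.
pose M := k + l + m; have M0 : 0 < M by rewrite !addr_gt0.
pose f (t : R) := rotmx S w (Num.sqrt (1 - t)) (Num.sqrt t).
have fE (t : R) : 0 <= t <= 1 ->
    f t = rscalemx (1 - t) w + rscalemx t x +
          rscalemx (Num.sqrt ((1 - t) * t)) y.
  move=> t01; rewrite /f /rotmx sqr_sqrtr ?sqr_sqrtr ?sqrtrM //; lra.
apply/homotopicP => //; exists f; split.
- move=> t t01; apply: is_unitary_rotmx => //.
  by rewrite !sqr_sqrtr; lra.
(* This makes [sqrt |s - t|] smaller than [eps / M], where [M] adds the bounds of the three
   matrices. *)
- move=> t t01 eps eps0; exists ((eps / M) ^+ 2).
    by rewrite exprn_gt0 // divr_gt0.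
  move=> s s01 std; pose r := Num.sqrt `|s - t|.
  have r_lt : r < eps / M.
    rewrite -(@ltr_pXn2r _ 2) ?nnegrE ?sqrtr_ge0 ?divr_ge0 ?ltW //.
    by rewrite sqr_sqrtr.
  have st_le : `|s - t| <= r.
    have st1 : `|s - t| <= 1 by rewrite ler_norml; lra.
    have rr : `|s - t| = r ^+ 2 by rewrite sqr_sqrtr.
    have r1 : r <= 1 by rewrite /r -sqrtr1 ler_sqrt.
    have r0 : 0 <= r by exact: sqrtr_ge0.
    by rewrite rr expr2 ler_piMr.
  (* The radicands differ by [(s - t) (1 - s - t)], whose second factor has absolute value at most
     1. *)
  have qst_le : `|Num.sqrt ((1 - s) * s) - Num.sqrt ((1 - t) * t)| <= r.
    apply: le_trans (sqrt_dist _ _) _; try nra.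
    rewrite /r ler_sqrt //.
    have -> : (1 - s) * s - (1 - t) * t = (s - t) * (1 - s - t) by ring.
    by rewrite normrM ler_piMr // ler_norml; lra.
  have -> : f s - f t = rscalemx (t - s) w + rscalemx (s - t) x +
      rscalemx (Num.sqrt ((1 - s) * s) - Num.sqrt ((1 - t) * t)) y.
    rewrite !fE //; set p := Num.sqrt _; set q := Num.sqrt _.
    rewrite !opprD -!rscalemxN [LHS]addrACA [X in X + _]addrACA -!rscalemxDl.
    by congr (rscalemx _ _ + _ + _); ring.
  have bd (z : 'M[V]_n) (K c : R) : 0 < K -> mxbd K z -> `|c| <= r ->
      mxbd (r * K) (rscalemx c z).
    move=> K0 Kz cr; apply: mxbd_le n0 _ (mxbd_rscale_norm c n0 (ltW K0) Kz).
    by rewrite ler_pM2r.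
  apply: (@mxbd_le _ _ _ (r * M)) => //.
    by rewrite -ler_pdivlMr // ltW.
  rewrite /M !mulrDr; apply: mxbdD => //; last exact: bd.
  by apply: mxbdD => //; apply: bd => //; rewrite distrC.
- rewrite fE ?lexx ?ler01 // mulr0 sqrtr0 !rscale0mx subr0 rscale1mx.
  by rewrite !addr0.
- rewrite fE ?lexx ?ler01 // subrr mul0r sqrtr0 !rscale0mx rscale1mx.
  by rewrite addr0 add0r.
Qed.

Lemma homotopic_tperm n (a b : 'I_n) (w : 'M[V]_n) :
  (0 < n)%N -> is_unitary w ->
  homotopic w (row_perm (tperm a b) (col_perm (tperm a b) w)).
Proof.
move=> n0 w1; pose S : 'M[R[i]]_n := perm_mx (tperm a b).
have SC : ctrmx S = S by rewrite /ctrmx tr_perm_mx map_perm_mx tpermV.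
have SS : S *m S = 1%:M by rewrite -perm_mxM tperm2 perm_mx1.
have := homotopic_conj_involution n0 SC SS w1.
rewrite scalemxl_perm scalemxr_perm tpermV.
suff -> : col_perm (tperm a b) (row_perm (tperm a b) w) =
          row_perm (tperm a b) (col_perm (tperm a b) w) by [].
by apply/matrixP => i j; rewrite !mxE.
Qed.

Lemma homotopic_perm n (s : 'S_n) (w : 'M[V]_n) :
  (0 < n)%N -> is_unitary w -> homotopic w (row_perm s (col_perm s w)).
Proof.
move=> n0 w1; have [ts -> _] := prod_tpermP s.
elim: ts => [|[a b] ts IH].
  rewrite big_nil.
  suff -> : row_perm 1 (col_perm 1 w) = w by exact: homotopic_refl.
  by apply/matrixP => i j; rewrite !mxE !perm1.
rewrite big_cons /=; set s' := (\prod_(t <- ts) tperm t.1 t.2)%g.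
have -> : row_perm (tperm a b * s') (col_perm (tperm a b * s') w) =
    row_perm (tperm a b) (col_perm (tperm a b) (row_perm s' (col_perm s' w))).
  by apply/matrixP => i j; rewrite !mxE !permM.
apply: (homotopic_trans IH); apply: homotopic_tperm => //.
(* The end point of the homotopy [IH] is one of its values, hence unitary. *)
by have [f [fU _ _ <-]] := IH; apply: fU; rewrite ler01 lexx.
Qed.

End Homotopy.

(** * Images of homotopies under morphisms *)

Section HomotopyMap.
Context {R : realType} {V W : absMatrixOrderUnitType R}.
Variable f : unitalAbsMorphism V W.

(** A positive [v] equals [|v|], so its image is [|f v|], which is positive. *)
Lemma mxpos_map n (v : 'M[V]_n) : (0 < n)%N -> mxpos v -> mxpos (map_mx f v).
Proof.
move=> n0 v_pos; rewrite -(absmx_mxpos n0 v_pos) -absmx_morph //.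
exact: absmx_pos.
Qed.

Lemma mxbd_map n (k : R) (v : 'M[V]_n) : (0 < n)%N ->
  mxbd k v -> mxbd k (map_mx f v).
Proof.
move=> n0; rewrite /mxbd; have -> : starmx (map_mx f v) = map_mx f (starmx v).
  by apply/matrixP => i j; rewrite !mxE star_morph.
have -> : rscalemx k (unitmx_of W n) = map_mx f (rscalemx k (unitmx_of V n)).
  by rewrite -(map_unitmx_of f); apply/matrixP => i j; rewrite !mxE linearZ.
by rewrite -map_block_mx; apply: mxpos_map; rewrite addn_gt0 n0.
Qed.

Lemma homotopic_map n (u v : 'M[V]_n) : (0 < n)%N ->
  homotopic u v -> homotopic (map_mx f u) (map_mx f v).
Proof.
move=> n0 /(homotopicP _ _ n0)[g [gU gc g0 g1]].
apply/homotopicP => //; exists (fun t => map_mx f (g t)).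
rewrite /mxbd_path g0 g1; split=> //.
  by move=> t t01; apply: is_unitary_map => //; exact: gU.
move=> t t01 eps eps0; have [d d0 gd] := gc t t01 eps eps0.
exists d => // s s01 std; rewrite -map_mxB; apply: mxbd_map => //; exact: gd.
Qed.

End HomotopyMap.

(** * Stable equivalence of unitaries *)

Section Stabilization.
Context {R : realType} {V : absMatrixOrderUnitType R}.

(* The infinite matrix [u + e + e + ...]; [padmx] is one of its corners. *)
Definition extmx (u : unitary V) (i j : nat) : V :=
  match insub i, insub j with
  | Some i', Some j' => umx u i' j'
  | _, _ => if i == j then ounit else 0
  end.

Definition cornermx k (A : nat -> nat -> V) : 'M[V]_k := \matrix_(i, j) A i j.

Lemma extmx_lt (u : unitary V) i j
    (iu : (i < usize u)%N) (ju : (j < usize u)%N) :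
  extmx u i j = umx u (Ordinal iu) (Ordinal ju).
Proof. by rewrite /extmx !insubT. Qed.

Lemma extmx_ge (u : unitary V) i j : (usize u <= i)%N || (usize u <= j)%N ->
  extmx u i j = if i == j then ounit else 0.
Proof.
rewrite /extmx; case: insubP => //= i' iu ii; case: insubP => //= j' ju jj.
by rewrite leqNgt iu leqNgt ju.
Qed.

Lemma extmx_ord (u : unitary V) (i j : 'I_(usize u)) : extmx u i j = umx u i j.
Proof. by rewrite extmx_lt; congr (umx u _ _); apply: val_inj. Qed.

Lemma cornermx_dsum (u : unitary V) d :
  cornermx (usize u + d) (extmx u) = dsummx (umx u) (unitmx_of V d).
Proof.
apply/matrixP => i j; rewrite mxE.
case: (split_ordP i) => i' ->; case: (split_ordP j) => j' ->.
- by rewrite block_mxEul extmx_ord.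
- rewrite block_mxEur mxE extmx_ge ?leq_addr ?orbT //.
  by rewrite ltn_eqF //= ltn_addr.
- rewrite block_mxEdl mxE extmx_ge ?leq_addr //.
  by rewrite gtn_eqF //= ltn_addr.
- by rewrite block_mxEdr mxE extmx_ge ?leq_addr // eqn_add2l.
Qed.

Lemma padmx_ext (u : unitary V) k (lt_uk : (usize u < k)%N) :
  padmx lt_uk (umx u) = cornermx k (extmx u).
Proof.
by rewrite /padmx -cornermx_dsum; apply/matrixP => i j; rewrite castmxE !mxE.
Qed.

(** With entries indexed by [nat], associativity and commutativity of direct sums become arithmetic
    on indices, free of casts between matrix sizes. *)
Lemma extmx_dsum (u v : unitary V) i j :
  extmx (udsum u v) i j =
  if (i < usize u)%N && (j < usize u)%N then extmx u i j
  else if (i < usize u)%N || (j < usize u)%N then 0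
  else extmx v (i - usize u) (j - usize u).
Proof.
case: (boolP ((i < usize (udsum u v))%N && (j < usize (udsum u v))%N)).
  case/andP => iuv juv; rewrite extmx_lt /=.
  case: (split_ordP (Ordinal iuv)) => i' ii;
    case: (split_ordP (Ordinal juv)) => j' jj;
    rewrite ii jj ?(block_mxEul, block_mxEur, block_mxEdl, block_mxEdr);
    rewrite ?mxE //=;
    have /= iE := congr1 val ii; have /= jE := congr1 val jj.
  - by rewrite iE jE extmx_ord.
  - by rewrite iE jE !addKn extmx_ord.
rewrite negb_and -!leqNgt => /= ij; rewrite extmx_ge //.
have -> : ((i < usize u) && (j < usize u))%N = false by lia.
case: (boolP ((i < usize u) || (j < usize u))%N) => iju.
  by case: eqP => // ijE; exfalso; lia.
rewrite extmx_ge; last by lia.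
by case: eqP; case: eqP => // ? ?; exfalso; lia.
Qed.

Lemma cornermxD (u : unitary V) k d : (usize u <= k)%N ->
  cornermx (k + d) (extmx u) = dsummx (cornermx k (extmx u)) (unitmx_of V d).
Proof.
move=> uk; apply/matrixP => i j; rewrite mxE.
case: (split_ordP i) => i' ->; case: (split_ordP j) => j' ->.
- by rewrite block_mxEul mxE.
- rewrite block_mxEur mxE extmx_ge; last by rewrite /=; lia.
  by rewrite ltn_eqF //= ltn_addr.
- rewrite block_mxEdl mxE extmx_ge; last by rewrite /=; lia.
  by rewrite gtn_eqF //= ltn_addr.
- rewrite block_mxEdr mxE extmx_ge; last by rewrite /=; lia.
  by rewrite eqn_add2l.
Qed.

Lemma cornermx_udsum (u v : unitary V) k :
  cornermx (usize u + k) (extmx (udsum u v)) =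
  dsummx (umx u) (cornermx k (extmx v)).
Proof.
apply/matrixP => i j; rewrite mxE extmx_dsum.
case: (split_ordP i) => i' ->; case: (split_ordP j) => j' ->;
  rewrite ?(block_mxEul, block_mxEur, block_mxEdl, block_mxEdr) ?mxE //=.
- by rewrite extmx_ord.
- by rewrite !addKn.
Qed.

Lemma is_unitary_cornermx (u : unitary V) k : (usize u <= k)%N ->
  is_unitary (cornermx k (extmx u)).
Proof.
move=> uk; have uE : cornermx (usize u) (extmx u) = umx u.
  by apply/matrixP => i j; rewrite mxE extmx_ord.
have [d ->] : exists d, k = (usize u + d)%N by exists (k - usize u)%N; lia.
case: d => [|d]; first by rewrite addn0 uE; exact: umxP.
rewrite cornermx_dsum; apply: is_unitary_dsum => //; first exact: usize_gt0.
  exact: umxP.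
exact: is_unitary_unitmx.
Qed.

(** The constant path at a unit is added as a direct summand. This brings homotopies found in
    different sizes to a common one. *)
Lemma homotopic_cornermx (u v : unitary V) k l :
  (usize u <= k)%N -> (usize v <= k)%N -> (k <= l)%N ->
  homotopic (cornermx k (extmx u)) (cornermx k (extmx v)) ->
  homotopic (cornermx l (extmx u)) (cornermx l (extmx v)).
Proof.
move=> uk vk kl h; have u0 := usize_gt0 u.
have [d ->] : exists d, l = (k + d)%N by exists (l - k)%N; lia.
(* Direct sums are controlled only for positive sizes, so [d = 0] is treated apart. *)
case: d => [|d]; first by rewrite addn0.
rewrite !cornermxD //; apply: homotopic_dsuml => //; first by lia.
exact: is_unitary_unitmx.
Qed.

End Stabilization.

(** * Direct sums up to stable homotopy *)

Section SimEquivalence.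
Context {R : realType} {V : absMatrixOrderUnitType R}.
Implicit Types u v w : unitary V.

Lemma sim1P u v :
  sim1 u v <-> exists k, [/\ (usize u < k)%N, (usize v < k)%N &
    homotopic (cornermx k (extmx u)) (cornermx k (extmx v))].
Proof.
split=> [[k [uk [vk]]]|[k [uk vk h]]].
  by rewrite !padmx_ext => h; exists k.
by exists k, uk, vk; rewrite !padmx_ext.
Qed.

(** A constant path in a large corner suffices. Unitaries whose sizes or proofs differ formally are
    compared in this way. *)
Lemma sim1_ext u v : extmx u =2 extmx v -> sim1 u v.
Proof.
move=> uv; apply/sim1P; exists (usize u + usize v).+1; split; try lia.
have -> : cornermx (usize u + usize v).+1 (extmx v) = cornermx _ (extmx u).
  by apply/matrixP => i j; rewrite !mxE uv.
by apply: homotopic_refl => //; apply: is_unitary_cornermx; lia.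
Qed.

Lemma sim1_refl u : sim1 u u. Proof. exact: sim1_ext. Qed.

Lemma sim1_sym u v : sim1 u v -> sim1 v u.
Proof.
case/sim1P => k [uk vk h]; apply/sim1P; exists k; split=> //.
exact: homotopic_sym.
Qed.

Lemma sim1_trans u v w : sim1 u v -> sim1 v w -> sim1 u w.
Proof.
case/sim1P => k [uk vk uv] /sim1P[l [vl wl vw]].
apply/sim1P; exists (k + l)%N; split; try lia.
apply: (@homotopic_trans _ _ _ _ (cornermx (k + l) (extmx v))).
  by apply: homotopic_cornermx uv; lia.
by apply: homotopic_cornermx vw; lia.
Qed.

Lemma sim1_dsumr w u v : sim1 u v -> sim1 (udsum w u) (udsum w v).
Proof.
case/sim1P => k [uk vk uv]; apply/sim1P; exists (usize w + k)%N.
split; rewrite /= ?ltn_add2l // !cornermx_udsum.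
by apply: homotopic_dsumr uv; [exact: usize_gt0 | lia | exact: umxP].
Qed.

Lemma sim1_dsumA u v w : sim1 (udsum u (udsum v w)) (udsum (udsum u v) w).
Proof.
apply: sim1_ext => i j; rewrite !extmx_dsum /=.
repeat (case: ifP => ? //; try by exfalso; lia).
by rewrite !subnDA.
Qed.

(** The corner of [v + u] is that of [u + v] with rows and columns permuted by [g], which exchanges
    the two blocks and fixes the tail; [homotopic_perm] joins them. *)
Lemma sim1_dsumC u v : sim1 (udsum u v) (udsum v u).
Proof.
(* [sim1] asks for a size strictly above [m + n], so one tail index appears besides the two
   blocks. *)
set m := usize u; set n := usize v; set k := (m + n).+1.
pose g i :=
  (if i < n then m + i else if i < m + n then i - n else i)%N.
pose h i :=
  (if i < m then n + i else if i < m + n then i - m else i)%N.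
have gk (i : 'I_k) : (g i < k)%N.
  by rewrite /g; have := ltn_ord i; repeat case: ifP => ?; lia.
have gK : cancel g h.
  move=> i; rewrite /g; case: ifP => ?; last case: ifP => ?; rewrite /h;
    by repeat case: ifP => ?; lia.
have g_inj : injective (fun i : 'I_k => Ordinal (gk i)).
  by move=> i j /(congr1 val) /= /(can_inj gK) /val_inj.
apply/sim1P; exists k; split; rewrite /= -/m -/n; try lia.
have U := @is_unitary_cornermx _ _ (udsum u v) k (leqnSn _).
have := homotopic_perm (perm g_inj) (ltn0Sn _) U.
congr homotopic; apply/matrixP => i j; rewrite !mxE !permE /=.
have gE (a : nat) : [\/ (a < n)%N /\ g a = (m + a)%N,
    (n <= a < m + n)%N /\ g a = (a - n)%N | (m + n <= a)%N /\ g a = a].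
  by rewrite /g; case: ifP => ?; [|case: ifP => ?];
    [constructor 1|constructor 2|constructor 3]; split=> //; lia.
have ext0 (w : unitary V) a b :
    (usize w <= a)%N || (usize w <= b)%N -> a <> b -> extmx w a b = 0.
  by move=> ab /eqP/negPf abN; rewrite extmx_ge // abN.
rewrite !extmx_dsum -/m -/n; move: (val i) (val j) => {U gk g_inj}a b {i j}.
case: (gE a) => -[? ->]; case: (gE b) => -[? ->];
  repeat (case: ifP => ? //; try by exfalso; lia).
all: try by congr (extmx _ _ _); lia.
(* One index lies in a block and the other in the tail: the entry left to treat is off the diagonal
   and beyond the size of its unitary. *)
1-4: by rewrite ext0 // /m /n; lia.
(* Both indices lie in the tail, where both sides are entries of the infinite unit. *)
rewrite !extmx_ge; try by rewrite -/m -/n; lia.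
by do 2!case: eqP => // ?; exfalso; lia.
Qed.

(** [sim1_dsumr] changes the right summand; commutativity carries the left one there and back. *)
Lemma sim1_dsum u u' v v' :
  sim1 u u' -> sim1 v v' -> sim1 (udsum u v) (udsum u' v').
Proof.
move=> uu vv; apply: sim1_trans (sim1_dsumr u' vv).
apply: sim1_trans (sim1_dsumC u v) _; apply: sim1_trans (sim1_dsumC v u').
exact: sim1_dsumr.
Qed.

Lemma sim1_dsumACA u v w x :
  sim1 (udsum (udsum u v) (udsum w x)) (udsum (udsum u w) (udsum v x)).
Proof.
apply: sim1_trans (sim1_sym (sim1_dsumA _ _ _)) _.
apply: sim1_trans (sim1_dsumA _ _ _); apply: sim1_dsumr.
apply: sim1_trans (sim1_dsumA _ _ _) _.
apply: sim1_trans (sim1_sym (sim1_dsumA _ _ _)).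
exact: sim1_dsum (sim1_dsumC _ _) (sim1_refl _).
Qed.

End SimEquivalence.

(** * Cancellation and formal differences *)

Section ApproxEquivalence.
Context {R : realType} {V : absMatrixOrderUnitType R}.
Implicit Types u v w : unitary V.

Lemma sim1_approx1 u v : sim1 u v -> approx1 u v.
Proof. by move=> uv; exists u; exact: sim1_dsum (sim1_refl u). Qed.

Lemma approx1_sym u v : approx1 u v -> approx1 v u.
Proof. by case=> w h; exists w; exact: sim1_sym. Qed.

Lemma approx1_dsum u u' v v' :
  approx1 u u' -> approx1 v v' -> approx1 (udsum u v) (udsum u' v').
Proof.
case=> w uu [x vv]; exists (udsum w x).
apply: sim1_trans (sim1_dsumACA _ _ _ _) _.
apply: sim1_trans (sim1_dsumACA _ _ _ _); exact: sim1_dsum.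
Qed.

Lemma approx1_trans u v w : approx1 u v -> approx1 v w -> approx1 u w.
Proof.
(* The chain runs from [(u + x) + y] to [(v + x) + y], then from [(v + y) + x] to [(w + y) + x]. *)
case=> x uv [y vw]; exists (udsum x y).
apply: sim1_trans (sim1_dsumA _ _ _) _.
apply: sim1_trans (sim1_dsum uv (sim1_refl y)) _.
apply: sim1_trans (sim1_sym (sim1_dsumA _ _ _)) _.
apply: sim1_trans (sim1_dsumr _ (sim1_dsumC _ _)) _.
apply: sim1_trans (sim1_dsumA _ _ _) _.
apply: sim1_trans (sim1_dsum vw (sim1_refl x)) _.
apply: sim1_trans (sim1_sym (sim1_dsumA _ _ _)) _.
exact: sim1_dsumr _ (sim1_dsumC _ _).
Qed.

(** The common summand is absorbed into the witness of [approx1]. *)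
Lemma approx1_cancel u v w : approx1 (udsum u w) (udsum v w) -> approx1 u v.
Proof.
case=> x h; exists (udsum w x); apply: sim1_trans (sim1_dsumA _ _ _) _.
exact: sim1_trans h (sim1_sym (sim1_dsumA _ _ _)).
Qed.

Lemma equiv1_refl p : @equiv1 R V p p.
Proof. exact/sim1_approx1/sim1_refl. Qed.

Lemma equiv1_sym p q : @equiv1 R V p q -> equiv1 q p.
Proof. exact: approx1_sym. Qed.

Lemma equiv1_trans p q r : @equiv1 R V p q -> equiv1 q r -> equiv1 p r.
Proof.
case: p q r => [a b] [c d] [g f] pq qr; rewrite /equiv1 /= in pq qr *.
(* The sum of the two hypotheses, after rearrangement, is the goal with [c + d] added to both
   sides. *)
apply: (@approx1_cancel _ _ (udsum c d)).
apply: approx1_trans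
  (sim1_approx1 (sim1_dsum (sim1_refl _) (sim1_dsumC _ _))) _.
apply: approx1_trans (sim1_approx1 (sim1_dsumACA _ _ _ _)) _.
apply: approx1_trans
  (approx1_dsum pq (approx1_trans (sim1_approx1 (sim1_dsumC _ _)) qr)) _.
apply: sim1_approx1.
apply: sim1_trans (sim1_dsum (sim1_dsumC _ _) (sim1_refl _)) _.
apply: sim1_trans (sim1_dsumACA _ _ _ _) _.
exact: sim1_dsum (sim1_dsumC _ _) (sim1_refl _).
Qed.

End ApproxEquivalence.

(** * The group and its functoriality *)

Section K1Group.
Context {R : realType} {V : absMatrixOrderUnitType R}.
Implicit Types p q : unitary V * unitary V.

Lemma K1_classP p q : K1_class p = K1_class q <-> equiv1 p q.
Proof.
split=> [/(congr1 sval) /= pq|pq].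
  have : [set r | equiv1 q r] q by exact: equiv1_refl.
  by rewrite -pq.
apply: eq_exist; apply/seteqP; split=> r /=; apply: equiv1_trans => //.
exact: equiv1_sym.
Qed.

Lemma K1_class_surj (x : K1 V) : exists p, x = K1_class p.
Proof. by exists (K1_repr x); rewrite K1_reprK. Qed.

Lemma K1_repr_class p : equiv1 (K1_repr (K1_class p)) p.
Proof. by apply/K1_classP; rewrite K1_reprK. Qed.

Definition upair_dsum p q := (udsum p.1 q.1, udsum p.2 q.2).

Lemma equiv1_dsum p p' q q' : equiv1 p p' -> equiv1 q q' ->
  equiv1 (upair_dsum p q) (upair_dsum p' q').
Proof.
move=> pp qq; apply: approx1_trans (sim1_approx1 (sim1_dsumACA _ _ _ _)) _.
apply: approx1_trans (sim1_approx1 (sim1_dsumACA _ _ _ _)).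
exact: approx1_dsum.
Qed.

Lemma K1_add_class p q :
  K1_add (K1_class p) (K1_class q) = K1_class (upair_dsum p q).
Proof. by apply/K1_classP; apply: equiv1_dsum; exact: K1_repr_class. Qed.

(** On representatives, with [r] for [z], the hypothesis has [r.1 + r.2] as a common summand, which
    [approx1_cancel] removes. *)
Lemma K1_addI (x y z : K1 V) : K1_add x z = K1_add y z -> x = y.
Proof.
have [p ->] := K1_class_surj x; have [q ->] := K1_class_surj y.
have [r ->] := K1_class_surj z.
rewrite !K1_add_class => /K1_classP h; apply/K1_classP.
apply: (@approx1_cancel _ _ _ _ (udsum r.1 r.2)).
apply: approx1_trans (sim1_approx1 (sim1_dsumACA _ _ _ _)) _.
apply: approx1_trans h (sim1_approx1 (sim1_dsumACA _ _ _ _)).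
Qed.

(** Unfolding [equiv1] leaves associativity, [(u + v) + e] against [u + (v + e)]. *)
Lemma K1_class_sub (u v : unitary V) :
  K1_add (K1_class (u, v)) (K1_class (v, unitary1)) = K1_class (u, unitary1).
Proof.
rewrite K1_add_class; apply/K1_classP; rewrite /equiv1 /=.
exact/sim1_approx1/sim1_sym/sim1_dsumA.
Qed.

End K1Group.

(** * The homomorphism induced by a morphism *)

Section K1Map.
Context {R : realType} {V W : absMatrixOrderUnitType R}.
Variable f : unitalAbsMorphism V W.

Lemma extmx_umap u i j : extmx (umap f u) i j = f (extmx u i j).
Proof.
case: (boolP ((i < usize u) && (j < usize u))%N) => [/andP[iu ju]|].
  by rewrite (extmx_lt iu ju) (@extmx_lt _ _ (umap f u) _ _ iu ju) mxE.
rewrite negb_and -!leqNgt => ij; rewrite !extmx_ge //.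
by case: ifP; rewrite ?ounit_morph ?raddf0.
Qed.

Lemma umap_udsum u v : sim1 (umap f (udsum u v)) (udsum (umap f u) (umap f v)).
Proof.
apply: sim1_ext => i j; rewrite extmx_umap !extmx_dsum /= !extmx_umap.
by case: ifP => // _; case: ifP; rewrite ?raddf0.
Qed.

Lemma umap_unitary1 : sim1 (umap f unitary1) unitary1.
Proof.
apply: sim1_ext => i j; rewrite extmx_umap.
have ext1 (Z : absMatrixOrderUnitType R) :
    extmx (@unitary1 R Z) i j = if i == j then ounit else 0.
  case: (boolP ((1 <= i)%N || (1 <= j)%N)) => [|].
    exact: (@extmx_ge R Z unitary1).
  rewrite negb_or -!eqn0Ngt => /andP[/eqP -> /eqP ->].
  by rewrite extmx_lt mxE.
by rewrite !ext1; case: ifP; rewrite ?ounit_morph ?raddf0.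
Qed.

Lemma sim1_umap u v : sim1 u v -> sim1 (umap f u) (umap f v).
Proof.
case/sim1P => k [uk vk uv]; apply/sim1P; exists k; split=> //.
have cE w : cornermx k (extmx (umap f w)) = map_mx f (cornermx k (extmx w)).
  by apply/matrixP => i j; rewrite !mxE extmx_umap.
by rewrite !cE; apply: homotopic_map uv; lia.
Qed.

Lemma approx1_umap u v : approx1 u v -> approx1 (umap f u) (umap f v).
Proof.
case=> w /sim1_umap uv; exists (umap f w).
exact: sim1_trans (sim1_sym (umap_udsum _ _)) (sim1_trans uv (umap_udsum _ _)).
Qed.

Definition umap_pair (p : unitary V * unitary V) := (umap f p.1, umap f p.2).

Lemma equiv1_umap p q : equiv1 p q -> equiv1 (umap_pair p) (umap_pair q).
Proof.
move=> /approx1_umap pq.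
apply: approx1_trans (sim1_approx1 (sim1_sym (umap_udsum _ _))) _.
exact: approx1_trans pq (sim1_approx1 (umap_udsum _ _)).
Qed.

Lemma is_K1_map_exists : exists F, is_K1_map f F.
Proof.
exists (fun x => K1_class (umap_pair (K1_repr x))).
(* The map is defined through chosen representatives; [FE] frees it from the choice. *)
have FE p :
    K1_class (umap_pair (K1_repr (K1_class p))) = K1_class (umap_pair p).
  by apply/K1_classP/equiv1_umap/K1_repr_class.
split=> [x y|v].
  have [p ->] := K1_class_surj x; have [q ->] := K1_class_surj y.
  rewrite K1_add_class !FE K1_add_class; apply/K1_classP.
  apply: sim1_approx1; apply: sim1_dsum; first exact: umap_udsum.
  exact/sim1_sym/umap_udsum.
rewrite FE; apply/K1_classP/sim1_approx1/sim1_dsumr.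
exact/sim1_sym/umap_unitary1.
Qed.

Lemma is_K1_map_unique F G : is_K1_map f F -> is_K1_map f G -> F = G.
Proof.
move=> [FD F1] [GD G1]; apply: funext => x; have [[u v] ->] := K1_class_surj x.
(* The added class is the common value of [F] and [G] at the class of [(v, e)], so additivity
   reduces both sides to the class of [(u, e)]. *)
apply: (@K1_addI _ _ _ _ (K1_class (umap f v, unitary1))).
by rewrite -{1}F1 -{1}G1 -FD -GD K1_class_sub F1 G1.
Qed.

(** [get] would return a default point if no such map existed; existence rules this out. *)
Lemma K1_mapP : is_K1_map f (K1_map f).
Proof. exact: (getPex (P := [set F | is_K1_map f F]) is_K1_map_exists). Qed.

Lemma K1_map_eq F : is_K1_map f F -> K1_map f = F.
Proof. by move=> fF; apply: is_K1_map_unique fF; exact: K1_mapP. Qed.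

End K1Map.

Theorem corollary3p19 (R : realType) (U V W : absMatrixOrderUnitType R)
    (phi : unitalAbsMorphism U V) (psi : unitalAbsMorphism V W) :
  @K1_map R V V idfun = idfun /\
  @K1_map R U W (psi \o phi) = K1_map psi \o K1_map phi.
Proof.
split; apply: K1_map_eq; split=> //=.
(* [umap idfun v] and [v] are compared through their infinite matrices instead of as records
   carrying proofs. *)
- move=> v; apply/K1_classP/sim1_approx1/sim1_dsum; last exact: sim1_refl.
  by apply: sim1_ext => i j; rewrite extmx_umap.
- by move=> x y; rewrite (K1_mapP phi).1 (K1_mapP psi).1.
- move=> v; rewrite (K1_mapP phi).2 (K1_mapP psi).2.
  apply/K1_classP/sim1_approx1/sim1_dsum; last exact: sim1_refl.
  by apply: sim1_ext => i j; rewrite !extmx_umap.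
Qed.
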